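(* Let $\alpha\in(0,2]$ and set $$\kappa_0=\begin{cases}\frac{\alpha}{6},&\alpha\in(0,1],\\[2pt] \frac16,&\alpha\in(1,2].\end{cases}$$ Then for every $\kappa<\kappa_0$, all dyadic $N\in2^{\mathbb{N}}$ and all $f\in L^2(\mathbb{T})$, $$\|P_Ne^{t\partial_x^3}f\|_{L^6_t([0,N^{-\alpha}],L^6_x(\mathbb{T}))}\ \lesssim\ N^{-\kappa}\|f\|_{L^2(\mathbb{T})},$$ with implicit constant independent of $N$ and $f$.
   Context: $\mathbb{T}=\mathbb{R}/(2\pi\mathbb{Z})$. $e^{t\partial_x^3}$ is the Airy propagator on $\mathbb{T}$, i.e. the unitary group generated by $\partial_x^3$ (a Fourier multiplier of modulus one with phase $\pm tk^3$, $k\in\mathbb{Z}$). $P_N$ is the smooth Littlewood–Paley projection to frequencies of modulus in $[N/2,2N]$. *)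

(* Defs.v *)
From mathcomp Require Import all_boot all_order all_algebra.
From mathcomp Require Import complex.
From mathcomp Require Import all_classical all_reals all_analysis.

Set Implicit Arguments.
Unset Strict Implicit.
Unset Printing Implicit Defensive.

Import Order.TTheory GRing.Theory Num.Theory.
Import numFieldNormedType.Exports.
Import ComplexField.

Local Open Scope classical_set_scope.
Local Open Scope ring_scope.
Local Open Scope complex_scope.

(* Functions on the torus R / (2 pi Z) are the 2 pi-periodic functions on R;
   integrals and norms over the torus are taken over the period [0, 2 pi[
   with the (unnormalized) Lebesgue measure. *)

Section Torus.
Variable R : realType.
Implicit Types (f g : R -> R[i]) (t x : R) (k : int).

Definition lebesgue_on (I : interval R) :=
  mrestr (@lebesgue_measure R) (measurable_itv I).

Definition torus_itv : interval R := `[0, 2 * pi[.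

Definition torus_Lnorm (p : R) f : \bar R :=
  Lnorm (lebesgue_on torus_itv) p%:E (fun x => (Normc.normc (f x))%:E).

(* The norm of L^q_t([0, T], L^p_x(torus)). *)
Definition spacetime_Lnorm (q p T : R) (u : R -> R -> R[i]) : \bar R :=
  Lnorm (lebesgue_on `[0, T]) q%:E (fun t => torus_Lnorm p (u t)).

Definition L2_torus f : Prop :=
  [/\ forall x, f (x + 2 * pi) = f x,
      measurable_fun setT (fun x => complex.Re (f x)),
      measurable_fun setT (fun x => complex.Im (f x))
    & (torus_Lnorm 2 f < +oo)%E].

Definition expi (x : R) : R[i] := cos x +i* sin x.

Definition torus_integral f : R[i] :=
  (\int[@lebesgue_measure R]_(x in [set` torus_itv]) complex.Re (f x))%R +i*
  (\int[@lebesgue_measure R]_(x in [set` torus_itv]) complex.Im (f x))%R.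

Definition fourier_coef f k : R[i] :=
  (2 * pi)^-1%:C * torus_integral (fun x => f x * expi (- (k%:~R * x))).

(* [g] is a representative of the image of [f] under the operator of L^2 of the
   torus which multiplies the k-th Fourier coefficient by [m k]. *)
Definition fourier_multiplier (m : int -> R[i]) f g : Prop :=
  L2_torus g /\ forall k, fourier_coef g k = m k * fourier_coef f k.

(* e^(t d_x^3): since d_x^3 e^(ikx) = (ik)^3 e^(ikx) = - i k^3 e^(ikx), its
   symbol is e^(- i t k^3). *)
Definition airy_propagator t f g : Prop :=
  fourier_multiplier (fun k => expi (- (t * k%:~R ^+ 3))) f g.

(* Smooth Littlewood-Paley bump: the psi(./N), N dyadic, form a smooth partition
   of unity on the nonzero frequencies. *)
Record lp_cutoff (psi : R -> R) : Prop := {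
  lp_smooth : forall n xi, derivable (derive1n n psi) xi 1;
  lp_range : forall xi, 0 <= psi xi <= 1;
  lp_support : forall xi, psi xi != 0 -> 1 / 2 <= `|xi| <= 2;
  lp_partition : forall xi, xi != 0 ->
    (\esum_(j in [set: int]) (psi (2 ^ j * xi))%:E = 1)%E }.

(* The multiplier operator with symbol psi(k/N). The support condition on psi
   makes the terms with |k| > 2N vanish; the sum below runs over
   k = j - 2N, 0 <= j <= 4N. *)
Definition lp_proj (psi : R -> R) (N : nat) f : R -> R[i] := fun x =>
  \sum_(j < (4 * N).+1)
    let k : int := j%:Z - (2 * N)%:Z in
    (psi (k%:~R / N%:R))%:C * fourier_coef f k * expi (k%:~R * x).

Definition kappa0 (alpha : R) : R := if alpha <= 1 then alpha / 6 else 1 / 6.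

End Torus.

(* Main.v *)
(* Split [lp_proj psi N (u t)] into positive and negative frequencies.  Each part
   is an exponential sum along the cubic [k -> (k, k^3)], [N/2 <= k <= 2N], and
   on the time interval [0, 1/M], [M <= N], the claim is an l^2 decoupling
   inequality into single frequencies, up to a factor [N^eps].  Replacing the
   time cutoff by the Fejer kernel and the integral by an average over a fine
   grid turns orthogonality into an exact statement: a product of three waves
   and three conjugate waves averages to zero unless the frequencies add up and
   the cubes add up within [N].

   Decoupling is proved by the bilinear iteration of efficient congruencing.
   Cut an interval of length [K^j] into [K] pieces.  Either one piece dominates
   (induct on [j]), or two separated pieces f, g are comparable, and then:
   - if g lives on a shorter interval, of length [B], then in the mean of
     |f|^2 |g|^4 the blocks of f of length about [K * B^2 / K^j] are almost
     orthogonal to each other;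
   - Cauchy-Schwarz exchanges |f|^2 |g|^4 with |f|^4 |g|^2 at the price of half
     of the linear estimate for g, known by induction.
   Alternating the two shrinks the blocks geometrically; each exchange gains the
   same power of [K^eps], while the total loss is a fixed power of [K].  With
   [K] fixed and enough exchanges the induction on [j] closes.

   The blocks are the K-adic ones, [k %/ K ^ i = r]. *)

Require Import Defs.
From mathcomp Require Import all_boot all_order all_algebra.
From mathcomp Require Import complex.
From mathcomp Require Import all_classical all_reals all_analysis.
From mathcomp Require Import measurable_realfun.
From mathcomp Require Import ring lra zify.

Set Implicit Arguments.
Unset Strict Implicit.
Unset Printing Implicit Defensive.

Import Order.TTheory GRing.Theory Num.Theory.
Import numFieldNormedType.Exports.
Import ComplexField.

Local Open Scope classical_set_scope.
Local Open Scope ring_scope.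

(** * Transversality of the cubic *)

(** The middle term is the second-order Taylor remainder of the cube at [c]: [l ^ 3 = c ^ 3 + 3 c ^
    2 (l - c) + (l - c) ^ 2 (l + 2 c)]. *)
Lemma cubic_taylor_remainder_bound (R : realDomainType) (N B c l : R) :
    0 <= c -> c <= 2 * N -> 0 <= l -> l <= 2 * N -> `|l - c| <= B ->
  0 <= (l - c) ^+ 2 * (l + 2 * c) <= 6 * N * B ^+ 2.
Proof.
move=> c0 c2N l0 l2N lB.
have B0 : 0 <= B by apply: le_trans lB.
have sq : (l - c) ^+ 2 <= B ^+ 2.
  by rewrite -[leLHS]real_normK ?num_real// ler_pXn2r// nnegrE.
apply/andP; split; first by rewrite mulr_ge0 ?sqr_ge0//; lra.
by rewrite [leRHS]mulrC; apply: ler_pM => //; rewrite ?sqr_ge0//; lra.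
Qed.

(** The quadratic factor is the slope of the chord of the cube over [k], [k'] minus the slope of its
    tangent at [c]. With [k] and [k'] on the same side of [c], the three products all differ from
    [c ^ 2] in the same direction, so nothing cancels. *)
Lemma quadratic_factor_bound (R : realDomainType) (N D c k k' : R) :
    0 <= c -> N <= 2 * c -> 0 < D -> 0 <= k -> 0 <= k' ->
    (c + D <= k /\ c + D <= k') \/ (k + D <= c /\ k' + D <= c) ->
  3 * N * D <= 2 * `|k ^+ 2 + k * k' + k' ^+ 2 - 3 * c ^+ 2|.
Proof.
move=> c0 Nc D0 k0 k'0 sep; set Q := (X in `|X|).
have ND : 3 * N * D <= 6 * c * D by rewrite ler_pM2r//; lra.
have [[s1 s2]|[s1 s2]] := sep.
  have h : 6 * c * D <= 2 * Q.
    have a1 : (c + D) ^+ 2 <= k ^+ 2 by rewrite ler_pXn2r// nnegrE; lra.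
    have a2 : (c + D) ^+ 2 <= k' ^+ 2 by rewrite ler_pXn2r// nnegrE; lra.
    have a3 : (c + D) ^+ 2 <= k * k' by rewrite expr2 ler_pM//; lra.
    have : 6 * c * D <= 3 * (c + D) ^+ 2 - 3 * c ^+ 2.
      by rewrite (_ : _ - _ = 6 * c * D + 3 * D ^+ 2); [rewrite lerDl; nra|ring].
    have : 0 <= c * D by nra.
    rewrite /Q; lra.
  by have := ler_norm Q; lra.
have cD : 0 <= c - D by lra.
have a1 : k ^+ 2 <= (c - D) ^+ 2 by rewrite ler_pXn2r ?nnegrE//; lra.
have a2 : k' ^+ 2 <= (c - D) ^+ 2 by rewrite ler_pXn2r ?nnegrE//; lra.
have a3 : k * k' <= (c - D) ^+ 2 by rewrite expr2 ler_pM//; lra.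
(* Below [c] the difference is [6 c D - 3 D ^ 2]; since [D <= c], half of the main term survives. *)
have : 3 * c * D <= 3 * c ^+ 2 - 3 * (c - D) ^+ 2.
  rewrite (_ : _ - _ = 3 * c * D + 3 * ((c - D) * D)); last by ring.
  by rewrite lerDl; nra.
have := ler_norm (- Q); rewrite normrN /Q; lra.
Qed.

(* Expanding the cubes around [l1] makes the linear terms cancel: what is left
   is [k - k'] times a quadratic factor of size [N * D], against remainders of
   size [N * B ^+ 2]; the factor [N] is common to both sides. *)
Lemma cubic_separation (R : realDomainType) (N B D k k' l1 l2 l3 l4 : R) :
    0 < N -> 1 <= B -> 0 < D -> 0 <= k -> 0 <= k' -> N <= 2 * l1 ->
    l1 <= 2 * N -> 0 <= l2 <= 2 * N -> 0 <= l3 <= 2 * N -> 0 <= l4 <= 2 * N ->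
    `|l2 - l1| <= B -> `|l3 - l1| <= B -> `|l4 - l1| <= B ->
    (l1 + D <= k /\ l1 + D <= k') \/ (k + D <= l1 /\ k' + D <= l1) ->
    k + l1 + l2 = k' + l3 + l4 ->
    `|k ^+ 3 + l1 ^+ 3 + l2 ^+ 3 - k' ^+ 3 - l3 ^+ 3 - l4 ^+ 3| <= N ->
  D * `|k - k'| <= 9 * B ^+ 2.
Proof.
move=> N0 B1 D0 k0 k'0 l11 l12 /andP[l2b l2B] /andP[l3b l3B] /andP[l4b l4B].
move=> d2 d3 d4 sep e0 hX.
have l10 : 0 <= l1 by lra.
have := quadratic_factor_bound l10 l11 D0 k0 k'0 sep.
have := cubic_taylor_remainder_bound l10 l12 l2b l2B d2.
have := cubic_taylor_remainder_bound l10 l12 l3b l3B d3.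
have := cubic_taylor_remainder_bound l10 l12 l4b l4B d4.
move: hX; set X := (X in `|X|).
have {X} -> : X = (k - k') * (k ^+ 2 + k * k' + k' ^+ 2 - 3 * l1 ^+ 2)
    + (l2 - l1) ^+ 2 * (l2 + 2 * l1) - (l3 - l1) ^+ 2 * (l3 + 2 * l1)
    - (l4 - l1) ^+ 2 * (l4 + 2 * l1).
  by rewrite /X (_ : k = k' + l3 + l4 - l1 - l2); [ring|lra].
move: (_ * (l2 + _)) (_ * (l3 + _)) (_ * (l4 + _)) (k ^+ 2 + _ + _ - _).
move=> e2 e3 e4 Q hX /andP[b4 b4'] /andP[b3 b3'] /andP[b2 b2'] hQ.
have hB : N <= N * B ^+ 2 by rewrite ler_peMr ?exprn_ege1 // ltW.
(* The three remainders are nonnegative and do not all carry the same sign, so at most two of them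
   add up: [13 = 1 + 2 * 6]. In the end [2 * 13 / 3 <= 9]. *)
have hP : `|k - k'| * `|Q| <= 13 * (N * B ^+ 2).
  move: hX; rewrite -normrM !ler_norml => /andP[? ?]; apply/andP; split; lra.
have : `|k - k'| * (3 * N * D) <= `|k - k'| * (2 * `|Q|) by rewrite ler_wpM2l.
rewrite mulrCA => h.
rewrite -(ler_pM2l N0); have : 0 <= N * B ^+ 2 by rewrite mulr_ge0 ?sqr_ge0 ?ltW.
lra.
Qed.

(** * Almost orthogonality and the broad-narrow dichotomy *)

(** This is [|r - s| <= d], written without truncated subtraction. *)
Definition near_ord (d : nat) (r s : nat) : bool := (r <= s + d)%N && (s <= r + d)%N.

Lemma near_ordC d r s : near_ord d r s = near_ord d s r.
Proof. by rewrite /near_ord andbC. Qed.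

Lemma card_near_ord Q d (r : nat) :
  (#|[pred s : 'I_Q | near_ord d r s]| <= d.*2.+1)%N.
Proof.
rewrite -(size_iota (r - d) d.*2.+1) -(size_image val).
apply: uniq_leq_size; first by rewrite map_inj_uniq ?enum_uniq//; exact: val_inj.
move=> _ /fintype.imageP[s + ->]; rewrite inE mem_iota /near_ord /= => /andP[h1 h2]; apply/andP; split; lia.
Qed.

(* The dichotomy: either every term far from the largest one is smaller by a
   factor [K], and the sum is at most four times the largest term, or some far
   pair of terms is comparable up to the factor [K]. *)
Lemma broad_narrow (R : realFieldType) (Q K : nat) (P : pred 'I_Q) (x : 'I_Q -> R) :
    (forall s, 0 <= x s) -> (#|P| <= K)%N ->
  (\sum_(s | P s) x s) ^+ 6 <= 4 ^+ 6 * (\sum_(s | P s) x s ^+ 6)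
    + K%:R ^+ 8 * \sum_(r | P r) \sum_(s | P s && ~~ near_ord 1 r s) x r ^+ 2 * x s ^+ 4.
Proof.
move=> x0 cardP.
have sum6 : 0 <= \sum_(s | P s) x s ^+ 6 by apply: sumr_ge0 => s _; rewrite exprn_ge0.
have far0 (r : 'I_Q) : 0 <= \sum_(s | P s && ~~ near_ord 1 r s) x r ^+ 2 * x s ^+ 4.
  by apply: sumr_ge0 => s _; rewrite mulr_ge0 ?exprn_ge0.
have sumfar : 0 <= \sum_(r | P r) \sum_(s | P s && ~~ near_ord 1 r s) x r ^+ 2 * x s ^+ 4.
  by apply: sumr_ge0 => r _; exact: far0.
have [/existsP[s0 Ps0]|/existsPn nP] := boolP [exists s, P s]; last first.
  by rewrite big_pred0 ?expr0n ?addr_ge0 ?mulr_ge0 ?exprn_ge0// => s; apply/negbTE.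
case: (@Order.TotalTheory.arg_maxP _ _ _ s0 P x Ps0) => m Pm maxm.
have K0 : (0 < K)%N by apply: leq_trans cardP; apply/card_gt0P; exists s0.
have K1 : 1 <= K%:R :> R by rewrite ler1n.
have [/existsP[r /and3P[Pr nr mr]]|/existsPn nfar] :=
    boolP [exists r, [&& P r, ~~ near_ord 1 r m & x m <= K%:R * x r]].
  have h1 : \sum_(s | P s) x s <= K%:R * x m.
    apply: (@le_trans _ _ (\sum_(s | P s) x m)); first exact: ler_sum.
    by rewrite sumr_const -[leLHS]mulr_natl ler_wpM2r// ler_nat.
  apply: (@le_trans _ _ ((K%:R * x m) ^+ 6)).
    by rewrite ler_pXn2r// nnegrE ?sumr_ge0// mulr_ge0// ler0n.
  (* The exponent 8 is 6 from the number of terms and 2 from replacing [x m ^ 2] by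
     [(K * x r) ^ 2]. *)
  apply: (@le_trans _ _ (K%:R ^+ 8 * (x r ^+ 2 * x m ^+ 4))).
    have : x m ^+ 2 <= (K%:R * x r) ^+ 2.
      by rewrite ler_pXn2r// nnegrE// mulr_ge0// ler0n.
    move=> h; have := ler_wpM2l (_ : 0 <= K%:R ^+ 6 * x m ^+ 4) h.
    rewrite mulr_ge0 ?exprn_ge0// => /(_ isT).
    by rewrite [X in X <= _ -> _](_ : _ = (K%:R * x m) ^+ 6) ?[X in _ <= X -> _](_ : _ = K%:R ^+ 8 * (x r ^+ 2 * x m ^+ 4)) //; ring.
  rewrite -[leLHS]add0r lerD ?mulr_ge0 ?exprn_ge0//.
  rewrite ler_wpM2l ?exprn_ge0//.
  rewrite (bigD1 r) //= -[leLHS]addr0 lerD//.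
    rewrite (bigD1 m) ?Pm//= -[leLHS]addr0 lerD//.
    by apply: sumr_ge0 => s _; rewrite mulr_ge0 ?exprn_ge0.
  by apply: sumr_ge0 => s _; exact: far0.
(* At most three indices are near [m], each contributing at most [x m]; the far ones are at most [K]
   in number and each is below [x m / K]. *)
have h1 : \sum_(s | P s) x s <= 4 * x m.
  rewrite (bigID (fun s : 'I_Q => near_ord 1 m s))/= (_ : 4 = 3 + 1); last by ring.
  rewrite mulrDl lerD//.
    apply: (@le_trans _ _ (\sum_(s | P s && near_ord 1 m s) x m)).
      by apply: ler_sum => s /andP[Ps _]; exact: maxm.
    rewrite sumr_const -[leLHS]mulr_natl ler_wpM2r//.
    rewrite ler_nat; apply: leq_trans (card_near_ord Q 1 m).
    by apply: subset_leq_card; apply/fintype.subsetP => s; rewrite !inE => /andP[].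
  rewrite mul1r -(@ler_pM2l _ K%:R) ?(lt_le_trans ltr01)// mulr_sumr.
  apply: (@le_trans _ _ (\sum_(s | P s && ~~ near_ord 1 m s) x m)).
    apply: ler_sum => s /andP[Ps fs].
    by have := nfar s; rewrite Ps near_ordC fs/= -ltNge => /ltW.
  rewrite sumr_const -[leLHS]mulr_natl ler_wpM2r// ler_nat.
  by apply: leq_trans cardP; apply: subset_leq_card; apply/fintype.subsetP => s /andP[].
apply: (@le_trans _ _ ((4 * x m) ^+ 6)).
  by rewrite ler_pXn2r// nnegrE ?sumr_ge0// mulr_ge0// ler0n.
rewrite -[leLHS]addr0 lerD ?mulr_ge0 ?exprn_ge0//.
rewrite exprMn ler_wpM2l ?exprn_ge0//.
by rewrite (bigD1 m)//= lerDl sumr_ge0// => s _; rewrite exprn_ge0.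
Qed.

(** * Moduli of complex numbers *)

Section NormcFacts.
Context {R : rcfType}.
Local Open Scope complex_scope.
Implicit Types z : R[i].

Lemma normc_ge0 z : 0 <= Normc.normc z.
Proof. by case: z => a b /=; rewrite sqrtr_ge0. Qed.

Lemma normc_conjc z : Normc.normc z^* = Normc.normc z.
Proof. by case: z => a b /=; rewrite sqrrN. Qed.

Lemma normc_real (x : R) : 0 <= x -> Normc.normc x%:C = x.
Proof. by move=> x0 /=; rewrite expr0n addr0 sqrtr_sqr ger0_norm. Qed.

Lemma normc_sqr z : Normc.normc z ^+ 2 = complex.Re z ^+ 2 + complex.Im z ^+ 2.
Proof. by case: z => a b /=; rewrite sqr_sqrtr// addr_ge0// sqr_ge0. Qed.

Lemma mulcJ z : z * z^* = (Normc.normc z ^+ 2)%:C.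
Proof.
case: z => a b; rewrite normc_sqr; apply/eqP; rewrite eq_complex /=.
by apply/andP; split; apply/eqP; ring.
Qed.

Lemma normc_sum (I : Type) (s : seq I) (P : pred I) (F : I -> R[i]) :
  Normc.normc (\sum_(i <- s | P i) F i) <= \sum_(i <- s | P i) Normc.normc (F i).
Proof.
elim/big_rec2: _ => [|i y1 y2 _ h]; first by rewrite Normc.normc0.
by apply: le_trans (le_normcD _ _) _; rewrite lerD2l.
Qed.

End NormcFacts.

(* Only the pairs of neighbouring indices survive, and each of their cross terms
   is at most the mean of two diagonal ones. *)
Lemma almost_orthogonality (R : rcfType) (Om : finType) (Q d : nat) (P : pred 'I_Q)
    (g : 'I_Q -> Om -> R[i]) (h : Om -> R) :
    (forall p, 0 <= h p) ->
    (forall r s, P r -> P s -> ~~ near_ord d r s ->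
      \sum_p ((h p)%:C)%C * (g r p * ((g s p)^*)%C) = 0) ->
  \sum_p h p * Normc.normc (\sum_(r | P r) g r p) ^+ 2
    <= d.*2.+1%:R * \sum_(r | P r) \sum_p h p * Normc.normc (g r p) ^+ 2.
Proof.
move=> h0 orth; set L := (X in X <= _).
have L0 : 0 <= L by apply: sumr_ge0 => p _; rewrite mulr_ge0 ?exprn_ge0 ?normc_ge0.
have LE : (L%:C)%C = \sum_(r | P r) \sum_(s | P s && near_ord d r s)
    \sum_p ((h p)%:C)%C * (g r p * ((g s p)^*)%C).
  transitivity (\sum_(r | P r) \sum_(s | P s)
      \sum_p ((h p)%:C)%C * (g r p * ((g s p)^*)%C)).
    rewrite /L rmorph_sum/=.
    under eq_bigr => p _ do rewrite rmorphM/= -mulcJ rmorph_sum/= big_distrl mulr_sumr/=.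
    rewrite exchange_big; apply: eq_bigr => r _.
    rewrite exchange_big/=; apply: eq_bigr => p _.
    by rewrite !mulr_sumr.
  apply: eq_bigr => r Pr; rewrite (bigID (fun s : 'I_Q => near_ord d r s))/=.
  rewrite [X in _ + X]big1 ?addr0// => s /andP[Ps ns]; exact: orth.
rewrite -[L]normc_real// LE.
apply: (@le_trans _ _ (\sum_(r | P r) \sum_(s | P s && near_ord d r s)
   \sum_p h p * ((Normc.normc (g r p) ^+ 2 + Normc.normc (g s p) ^+ 2) / 2))).
  apply: le_trans (normc_sum _ _ _) _; apply: ler_sum => r _.
  apply: le_trans (normc_sum _ _ _) _; apply: ler_sum => s _.
  apply: le_trans (normc_sum _ _ _) _; apply: ler_sum => p _.
  rewrite !Normc.normcM normc_conjc normc_real// ler_wpM2l//.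
  have := sqr_ge0 (Normc.normc (g r p) - Normc.normc (g s p)).
  lra.
pose G r := \sum_p h p * Normc.normc (g r p) ^+ 2.
have G0 r : 0 <= G r by apply: sumr_ge0 => p _; rewrite mulr_ge0 ?exprn_ge0 ?normc_ge0.
rewrite [X in X <= _](_ : _ = \sum_(r | P r) \sum_(s | P s && near_ord d r s) G r / 2
    + \sum_(r | P r) \sum_(s | P s && near_ord d r s) G s / 2); last first.
  rewrite -big_split/=; apply: eq_bigr => r _.
  rewrite -big_split/=; apply: eq_bigr => s _.
  rewrite /G -mulrDl -big_split/= mulr_suml; apply: eq_bigr => p _; ring.
have half : \sum_(r | P r) \sum_(s | P s && near_ord d r s) G r / 2
    <= d.*2.+1%:R * \sum_(r | P r) G r / 2.
  rewrite mulr_sumr; apply: ler_sum => r _.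
  rewrite sumr_const -[leLHS]mulr_natl ler_wpM2r ?divr_ge0//.
  rewrite ler_nat; apply: leq_trans (card_near_ord Q d r).
  by apply: subset_leq_card; apply/fintype.subsetP => s; rewrite !inE => /andP[].
apply: (@le_trans _ _ (d.*2.+1%:R * (\sum_(r | P r) G r / 2)
    + d.*2.+1%:R * (\sum_(r | P r) G r / 2))); last first.
  by rewrite -mulrDr -mulr_suml -splitr.
rewrite lerD//.
(* Since [near_ord] is symmetric, exchanging the two indices turns the second half into the
   first. *)
rewrite (exchange_big_dep P)/=; last by move=> r s _ /andP[].
apply: le_trans half; apply: ler_sum => r Pr.
by rewrite le_eqVlt; apply/orP; left; apply/eqP; apply: eq_bigl => s; rewrite Pr near_ordC.
Qed.

(** * Decoupling for averages over a finite set *)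

(** Lagrange's identity: the difference of the two sides is half of the double sum of
    [w i * w j * (f i * g j - f j * g i) ^ 2]. *)
Lemma sum_cauchy_schwarz (R : realFieldType) (I : finType) (w f g : I -> R) :
    (forall i, 0 <= w i) ->
  (\sum_i w i * (f i * g i)) ^+ 2
    <= (\sum_i w i * f i ^+ 2) * (\sum_i w i * g i ^+ 2).
Proof.
move=> w0.
have : 0 <= \sum_i \sum_j w i * w j * (f i * g j - f j * g i) ^+ 2.
  by apply: sumr_ge0 => i _; apply: sumr_ge0 => j _; apply: mulr_ge0; [exact: mulr_ge0|exact: sqr_ge0].
rewrite (_ : \sum_i _ = \sum_i \sum_j (w i * f i ^+ 2) * (w j * g j ^+ 2)
   + \sum_i \sum_j (w i * g i ^+ 2) * (w j * f j ^+ 2)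
   - 2 * \sum_i \sum_j (w i * (f i * g i)) * (w j * (f j * g j))); last first.
  rewrite mulr_sumr -big_split/= -sumrB; apply: eq_bigr => i _.
  rewrite mulr_sumr -big_split/= -sumrB; apply: eq_bigr => j _; ring.
have dbl (u v : I -> R) : \sum_i \sum_j u i * v j = (\sum_i u i) * (\sum_i v i).
  by rewrite mulr_suml; apply: eq_bigr => i _; rewrite mulr_sumr.
rewrite !dbl; lra.
Qed.

(** A block at level [i + d] is cut into its subblocks at level [i], because
    [k %/ K ^ (i + d) = (k %/ K ^ i) %/ K ^ d]. *)
Lemma sum_divn_split (V : nmodType) (Q K i d r : nat) (F : nat -> V) :
  \sum_(k < Q | (k %/ K ^ (i + d))%N == r) F k
    = \sum_(s < Q | (s %/ K ^ d)%N == r) \sum_(k < Q | (k %/ K ^ i)%N == s) F k.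
Proof.
have lt_div (k : 'I_Q) : (k %/ K ^ i < Q)%N by apply: leq_ltn_trans (ltn_ord k); exact: leq_div.
rewrite (partition_big (fun k => Ordinal (lt_div k)) (fun s : 'I_Q => (s %/ K ^ d)%N == r)).
  apply: eq_bigr => s /eqP sr; apply: eq_bigl => k; rewrite -val_eqE/=.
  rewrite expnD divnMA.
  by have [->|] := eqVneq (k %/ K ^ i)%N s; rewrite ?andbF// sr eqxx.
by move=> k /=; rewrite expnD divnMA.
Qed.

(** The finite form of what an average over the torus in space and over a time of order [1/M],
    [M <= N], detects: the sum of the frequencies exactly, the sum of their cubes only up to [N]. *)
Definition orthogonal_off_resonance (R : rcfType) (Om : finType) (w : Om -> R)
    (e : nat -> Om -> R[i]) (N : nat) : Prop := forall k l1 l2 k' l3 l4 : nat,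
  (k <= 2 * N)%N -> (l1 <= 2 * N)%N -> (l2 <= 2 * N)%N ->
  (k' <= 2 * N)%N -> (l3 <= 2 * N)%N -> (l4 <= 2 * N)%N ->
  ~ ((k + l1 + l2 = k' + l3 + l4)%N /\
     `|k%:Z ^+ 3 + l1%:Z ^+ 3 + l2%:Z ^+ 3 - k'%:Z ^+ 3 - l3%:Z ^+ 3 - l4%:Z ^+ 3| <= N%:Z) ->
  \sum_p ((w p)%:C)%C * (e k p * e l1 p * e l2 p * ((e k' p * e l3 p * e l4 p)^*)%C) = 0.

Section Decoupling.
Context {R : rcfType} {Om : finType} (w : Om -> R) (e : nat -> Om -> R[i]).
Context (a : nat -> R[i]) (N : nat).
Hypothesis w_ge0 : forall p, 0 <= w p.
Hypothesis w_le1 : \sum_p w p <= 1.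
Hypothesis e_le1 : forall k p, Normc.normc (e k p) <= 1.
Hypothesis N_gt0 : (0 < N)%N.
Hypothesis a_supp : forall k, a k != 0 -> (N <= 2 * k)%N.
Hypothesis orth : orthogonal_off_resonance w e N.

Local Notation Q := (2 * N).+1.

Definition mean (g : Om -> R) : R := \sum_p w p * g p.

Lemma mean_ge0 g : (forall p, 0 <= g p) -> 0 <= mean g.
Proof. by move=> g0; apply: sumr_ge0 => p _; rewrite mulr_ge0. Qed.

Lemma ler_mean g h : (forall p, g p <= h p) -> mean g <= mean h.
Proof. by move=> gh; apply: ler_sum => p _; rewrite ler_wpM2l. Qed.

Lemma mean_sum (I : finType) (P : pred I) (g : I -> Om -> R) :
  mean (fun p => \sum_(i | P i) g i p) = \sum_(i | P i) mean (g i).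
Proof. by rewrite /mean exchange_big/=; apply: eq_bigr => p _; rewrite mulr_sumr. Qed.

Lemma meanZ c g : mean (fun p => c * g p) = c * mean g.
Proof. by rewrite /mean mulr_sumr; apply: eq_bigr => p _; rewrite mulrCA. Qed.

Lemma meanD g h : mean (fun p => g p + h p) = mean g + mean h.
Proof. by rewrite /mean -big_split/=; apply: eq_bigr => p _; rewrite mulrDr. Qed.

(** * The K-adic blocks and their bilinear interactions *)

Section Blocks.
Variable K : nat.
Hypothesis K_gt0 : (0 < K)%N.

Definition block i r p := \sum_(k < Q | (k %/ K ^ i)%N == r) a k * e k p.
Definition mass i r := \sum_(k < Q | (k %/ K ^ i)%N == r) Normc.normc (a k) ^+ 2.
Definition size_block i r p := Normc.normc (block i r p).

Lemma size_block_ge0 i r p : 0 <= size_block i r p.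
Proof. exact: normc_ge0. Qed.

Lemma mass_ge0 i r : 0 <= mass i r.
Proof. by apply: sumr_ge0 => k _; rewrite exprn_ge0 ?normc_ge0. Qed.

Lemma block_split i d r p :
  block (i + d) r p = \sum_(s < Q | (s %/ K ^ d)%N == r) block i s p.
Proof. exact: (sum_divn_split _ _ _ _ _ (fun k => a k * e k p)). Qed.

Lemma mass_split i d r :
  mass (i + d) r = \sum_(s < Q | (s %/ K ^ d)%N == r) mass i s.
Proof. exact: (sum_divn_split _ _ _ _ _ (fun k => Normc.normc (a k) ^+ 2)). Qed.

Lemma card_block i r : (#|[pred k : 'I_Q | (k %/ K ^ i)%N == r]| <= K ^ i)%N.
Proof.
rewrite -[leqRHS](size_iota (r * K ^ i)) -(size_image val).
apply: uniq_leq_size; first by rewrite map_inj_uniq ?enum_uniq//; exact: val_inj.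
move=> _ /fintype.imageP[k + ->]; rewrite inE mem_iota => /eqP <-.
by rewrite leq_divM/= -mulSnr ltn_ceil// expn_gt0 K_gt0.
Qed.

(** Cauchy-Schwarz against the indicator of the block, which has at most [K ^ i] elements. *)
Lemma size_block_sqr i r p : size_block i r p ^+ 2 <= (K ^ i)%:R * mass i r.
Proof.
have h : size_block i r p <= \sum_(k < Q | (k %/ K ^ i)%N == r) Normc.normc (a k).
  apply: le_trans (normc_sum _ _ _) _; apply: ler_sum => k _.
  by rewrite Normc.normcM ler_piMr ?normc_ge0.
apply: (@le_trans _ _ ((\sum_(k < Q | (k %/ K ^ i)%N == r) Normc.normc (a k)) ^+ 2)).
  rewrite ler_pXn2r// nnegrE ?normc_ge0// sumr_ge0// => k _; exact: normc_ge0.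
have := @sum_cauchy_schwarz R 'I_Q (fun k => ((k %/ K ^ i)%N == r)%:R)
   (fun k => Normc.normc (a k)) (fun=> 1) (fun=> ler0n _ _).
have ind (F : nat -> R) : \sum_(k < Q) ((k %/ K ^ i)%N == r)%:R * F k
   = \sum_(k < Q | (k %/ K ^ i)%N == r) F k.
  rewrite [RHS]big_mkcond/=; apply: eq_bigr => k _.
  by case: eqP => _; rewrite ?mul1r ?mul0r.
rewrite (ind (fun k => Normc.normc (a k) * 1)) (ind (fun k => Normc.normc (a k) ^+ 2)).
rewrite (ind (fun=> 1 ^+ 2)) expr1n sumr_const.
under eq_bigr do rewrite mulr1.
move=> h2; apply: le_trans h2 _.
by rewrite mulrC ler_wpM2r ?mass_ge0// ler_nat card_block.
Qed.

(** The loss is cubic in the length of the block, hence harmless for boundedly many scales: this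
    starts the induction. *)
Lemma mean_block6_trivial i r :
  mean (fun p => size_block i r p ^+ 6) <= (K ^ i)%:R ^+ 3 * mass i r ^+ 3.
Proof.
apply: (@le_trans _ _ (mean (fun=> ((K ^ i)%:R * mass i r) ^+ 3))).
  apply: ler_mean => p; rewrite (_ : 6%N = (2 * 3)%N)// exprM.
  by rewrite ler_pXn2r ?size_block_sqr// nnegrE ?exprn_ge0 ?mulr_ge0 ?mass_ge0 ?size_block_ge0.
by rewrite /mean -mulr_suml exprMn ler_piMl// mulr_ge0 ?exprn_ge0 ?mass_ge0.
Qed.

(** The order is the same for all pairs of elements; this supplies the one-sided alternative that
    [cubic_separation] asks for. *)
Definition separated D i1 r1 i2 r2 : Prop :=
  (forall k l : nat, (k %/ K ^ i1 = r1 -> l %/ K ^ i2 = r2 -> l + D <= k)%N) \/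
  (forall k l : nat, (k %/ K ^ i1 = r1 -> l %/ K ^ i2 = r2 -> k + D <= l)%N).

Definition bilinear_bound D i1 i2 Z := forall r1 r2, separated D i1 r1 i2 r2 ->
  mean (fun p => size_block i1 r1 p ^+ 2 * size_block i2 r2 p ^+ 4)
    <= Z * (mass i1 r1 * mass i2 r2 ^+ 2).

Lemma separated_sym D i1 r1 i2 r2 : separated D i1 r1 i2 r2 -> separated D i2 r2 i1 r1.
Proof. by case=> h; [right|left] => k l hk hl; exact: h. Qed.

Lemma separated_sub D i1 r1 i2 r2 d s :
  (s %/ K ^ d)%N = r1 -> separated D (i1 + d) r1 i2 r2 -> separated D i1 s i2 r2.
Proof.
move=> sr; case=> h; [left|right] => k l hk hl; apply: (h k l) => //;
by rewrite expnD divnMA hk.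
Qed.

Lemma sum_block_eq0 (P : pred nat) (G : Om -> R[i]) :
    (forall k, (k <= 2 * N)%N -> P k -> a k != 0 -> \sum_p ((w p)%:C)%C * (e k p * G p) = 0) ->
  \sum_p ((w p)%:C)%C * ((\sum_(k < Q | P k) a k * e k p) * G p) = 0.
Proof.
move=> h.
under eq_bigr => p _ do rewrite mulr_suml mulr_sumr.
rewrite exchange_big/= big1// => k Pk.
have [ak|ak] := eqVneq (a k) 0.
  by rewrite big1// => p _; rewrite ak !mul0r mulr0.
rewrite (_ : \sum_p _ = a k * \sum_p ((w p)%:C)%C * (e k p * G p)).
  by rewrite h ?mulr0// -ltnS ltn_ord.
rewrite mulr_sumr; apply: eq_bigr => p _; ring.
Qed.

Lemma sum_block_conj_eq0 (P : pred nat) (G : Om -> R[i]) :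
    (forall k, (k <= 2 * N)%N -> P k -> a k != 0 ->
      \sum_p ((w p)%:C)%C * (((e k p)^*)%C * G p) = 0) ->
  \sum_p ((w p)%:C)%C * (((\sum_(k < Q | P k) a k * e k p)^*)%C * G p) = 0.
Proof.
move=> h.
under eq_bigr => p _ do rewrite rmorph_sum mulr_suml mulr_sumr.
rewrite exchange_big/= big1// => k Pk.
have [ak|ak] := eqVneq (a k) 0.
  by rewrite big1// => p _; rewrite ak mul0r rmorph0 mul0r mulr0.
rewrite (_ : \sum_p _ = ((a k)^*)%C * \sum_p ((w p)%:C)%C * (((e k p)^*)%C * G p)).
  by rewrite h ?mulr0// -ltnS ltn_ord.
rewrite mulr_sumr; apply: eq_bigr => p _; rewrite rmorphM/=; ring.
Qed.

Definition restricted_sum (P : pred nat) p := \sum_(k < Q | P k) a k * e k p.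

(** By linearity it suffices to treat six single frequencies. The factors are expanded one at a
    time, the product being rotated each time so that the next factor stands in front. *)
Lemma sextilinear_eq0 (P1 P2 P3 P4 P5 P6 : pred nat) :
    (forall k1 k2 k3 k4 k5 k6,
      (k1 <= 2 * N)%N -> (k2 <= 2 * N)%N -> (k3 <= 2 * N)%N ->
      (k4 <= 2 * N)%N -> (k5 <= 2 * N)%N -> (k6 <= 2 * N)%N ->
      P1 k1 -> P2 k2 -> P3 k3 -> P4 k4 -> P5 k5 -> P6 k6 ->
      a k1 != 0 -> a k2 != 0 -> a k4 != 0 ->
      \sum_p ((w p)%:C)%C * (e k1 p * e k2 p * e k3 p * ((e k4 p * e k5 p * e k6 p)^*)%C) = 0) ->
  \sum_p ((w p)%:C)%C * (restricted_sum P1 p * restricted_sum P2 p * restricted_sum P3 p *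
    ((restricted_sum P4 p * restricted_sum P5 p * restricted_sum P6 p)^*)%C) = 0.
Proof.
move=> h; under eq_bigr do rewrite !rmorphM/= -!mulrA.
apply: sum_block_eq0 => k1 b1 p1 a1; under eq_bigr do rewrite [X in _ * X]mulrC -!mulrA.
apply: sum_block_eq0 => k2 b2 p2 a2; under eq_bigr do rewrite [X in _ * X]mulrC -!mulrA.
apply: sum_block_eq0 => k3 b3 p3 a3; under eq_bigr do rewrite [X in _ * X]mulrC -!mulrA.
apply: sum_block_conj_eq0 => k4 b4 p4 a4; under eq_bigr do rewrite [X in _ * X]mulrC -!mulrA.
apply: sum_block_conj_eq0 => k5 b5 p5 a5; under eq_bigr do rewrite [X in _ * X]mulrC -!mulrA.
apply: sum_block_conj_eq0 => k6 b6 p6 a6.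
rewrite -[RHS](h k1 k2 k3 k4 k5 k6)//; apply: eq_bigr => p _; rewrite !rmorphM/=; ring.
Qed.

(** At least [d] whole blocks of length [K ^ i] lie between the two. *)
Lemma block_far d i s s' k k' : ~~ near_ord d s s' ->
  (k %/ K ^ i)%N = s -> (k' %/ K ^ i)%N = s' ->
  (k' + d * K ^ i < k \/ k + d * K ^ i < k')%N.
Proof.
have aux m m' : ((m' %/ K ^ i) + d < m %/ K ^ i)%N -> (m' + d * K ^ i < m)%N.
  move=> lt; have Ki0 : (0 < K ^ i)%N by rewrite expn_gt0 K_gt0.
  have h1 := ltn_ceil m' Ki0; have h2 := leq_divM m (K ^ i).
  apply: leq_trans h2; apply: (@leq_trans ((m' %/ K ^ i).+1 * K ^ i + d * K ^ i)%N).
    by rewrite -addSn leq_add2r.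
  by rewrite -mulnDl leq_mul2r addSn lt orbT.
rewrite /near_ord negb_and -!ltnNge => /orP[h ks ks'|h ks ks'].
  by left; apply: aux; rewrite ks ks'.
by right; apply: aux; rewrite ks ks'.
Qed.

Lemma block_close i k l : (k %/ K ^ i = l %/ K ^ i)%N -> `|k%:Z - l%:Z| <= (K ^ i)%:Z.
Proof.
have Ki0 : (0 < K ^ i)%N by rewrite expn_gt0 K_gt0.
move=> kl; have := ltn_ceil k Ki0; have := ltn_ceil l Ki0.
have := leq_divM k (K ^ i); have := leq_divM l (K ^ i); rewrite kl mulSn.
set v := (K ^ i)%N; set u := (_ * v)%N; lia.
Qed.

(* Two subblocks of the first block interact only if they are close, because the
   second block is short. *)
Lemma bilinear_refine j i2 i3 d Z : (i2.*2 <= j.+1 + i3)%N ->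
  bilinear_bound (K ^ j) i3 i2 Z ->
  bilinear_bound (K ^ j) (i3 + d) i2 ((9 * K).*2.+1%:R * Z).
Proof.
move=> hi hZ r1 r2 sep.
pose h p := w p * size_block i2 r2 p ^+ 4.
have h0 p : 0 <= h p by rewrite mulr_ge0 ?exprn_ge0 ?size_block_ge0.
have -> : mean (fun p => size_block (i3 + d) r1 p ^+ 2 * size_block i2 r2 p ^+ 4)
   = \sum_p h p * Normc.normc (\sum_(s < Q | (s %/ K ^ d)%N == r1) block i3 s p) ^+ 2.
  by apply: eq_bigr => p _; rewrite -block_split /h /size_block; ring.
have fine (s : nat) : (s %/ K ^ d)%N == r1 -> mean (fun p => size_block i3 s p ^+ 2
    * size_block i2 r2 p ^+ 4) <= Z * (mass i3 s * mass i2 r2 ^+ 2).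
  by move=> /eqP sr; apply: hZ; exact: separated_sub sep.
apply: (@le_trans _ _ ((9 * K).*2.+1%:R * \sum_(s < Q | (s %/ K ^ d)%N == r1)
    mean (fun p => size_block i3 s p ^+ 2 * size_block i2 r2 p ^+ 4))); last first.
  rewrite -!mulrA ler_wpM2l// mass_split mulr_suml mulr_sumr.
  by apply: ler_sum => s; exact: fine.
rewrite [leRHS](_ : _ = (9 * K).*2.+1%:R * \sum_(s < Q | (s %/ K ^ d)%N == r1)
    \sum_p h p * Normc.normc (block i3 s p) ^+ 2); last first.
  congr (_ * _); apply: eq_bigr => s _; apply: eq_bigr => p _.
  by rewrite /h /size_block; ring.
apply: almost_orthogonality => // s s' /eqP sr /eqP sr' far.
(* The weight contains [|g| ^ 4]; two factors of [g] go with each of the two subblocks, one pair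
   being conjugated, which gives a sextilinear mean. *)
rewrite (_ : \sum_p _ = \sum_p ((w p)%:C)%C *
    (block i3 s p * block i2 r2 p * block i2 r2 p *
    ((block i3 s' p * block i2 r2 p * block i2 r2 p)^*)%C)); last first.
  apply: eq_bigr => p _.
  have -> : ((h p)%:C)%C = ((w p)%:C)%C * (block i2 r2 p * ((block i2 r2 p)^*)%C) ^+ 2.
    by rewrite mulcJ -rmorphXn -rmorphM -exprM.
  by rewrite !rmorphM/=; ring.
pose P i r k := (k %/ K ^ i)%N == r.
apply: (@sextilinear_eq0 (P i3 s) (P i2 r2) (P i2 r2) (P i3 s') (P i2 r2) (P i2 r2)) => k l1 l2 k' l3 l4 bk b1 b2 bk' b3 b4.
move=> /eqP ks /eqP e1 /eqP e2 /eqP ks' /eqP e3 /eqP e4 ak al ak'.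
apply: orth => // -[sum_eq cub].
have Nk := a_supp ak; have Nk' := a_supp ak'; have Nl := a_supp al.
have Kj0 : (0 < K ^ j)%N by rewrite expn_gt0 K_gt0.
have Ki0 : (0 < K ^ i2)%N by rewrite expn_gt0 K_gt0.
have sepk : (l1%:Z + (K ^ j)%:Z <= k%:Z /\ l1%:Z + (K ^ j)%:Z <= k'%:Z) \/
   (k%:Z + (K ^ j)%:Z <= l1%:Z /\ k'%:Z + (K ^ j)%:Z <= l1%:Z).
  have kr : (k %/ K ^ (i3 + d))%N = r1 by rewrite expnD divnMA ks.
  have kr' : (k' %/ K ^ (i3 + d))%N = r1 by rewrite expnD divnMA ks'.
  case: sep => sep; [left|right]; split; rewrite -PoszD lez_nat; exact: sep.
have cl l : (l %/ K ^ i2)%N = r2 -> `|l%:Z - l1%:Z| <= (K ^ i2)%:Z.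
  by move=> lr; apply: block_close; rewrite lr e1.
have le2N l : (l <= 2 * N)%N -> 0 <= l%:Z <= 2 * N%:Z by clear; lia.
have sum_eq' : k%:Z + l1%:Z + l2%:Z = k'%:Z + l3%:Z + l4%:Z by rewrite -!PoszD sum_eq.
have Nl' : N%:Z <= 2 * l1%:Z by rewrite -PoszM lez_nat.
have /andP[_ bl] := le2N _ b1.
have c := cubic_separation (N_gt0 : 0 < N%:Z) (Ki0 : 1 <= (K ^ i2)%:Z)
  (Kj0 : 0 < (K ^ j)%:Z) (leq0n k : 0 <= k%:Z) (leq0n k' : 0 <= k'%:Z) Nl' bl
  (le2N _ b2) (le2N _ b3) (le2N _ b4) (cl _ e2) (cl _ e3) (cl _ e4) sepk sum_eq' cub.
(* This is where the relation between the levels enters. A resonance would give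
   [K ^ j * |k - k'| <= 9 * K ^ (2 * i2)], while subblocks more than [9 * K] apart give
   [|k - k'| > 9 * K * K ^ i3]. *)
have hK : ((K ^ i2) ^ 2 <= K ^ j * (K * K ^ i3))%N.
  by rewrite -expnM muln2 -expnS -expnD leq_pexp2l// addnS -addSn.
have kk : (9 * K * K ^ i3)%N%:Z < `|k%:Z - k'%:Z|.
  by case: (block_far far ks ks'); clear; set u := (_ * _)%N; lia.
have : (K ^ j)%:Z * (9 * K * K ^ i3)%N%:Z < 9 * (K ^ i2)%:Z ^+ 2.
  by apply: lt_le_trans c; rewrite ltr_pM2l.
rewrite -PoszM -[X in _ < X](_ : (9 * (K ^ i2) ^ 2)%N%:Z = _); last by rewrite PoszM; congr (_ * _); rewrite expr2 -PoszM.
rewrite ltz_nat ltnNge => /negP; apply.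
by rewrite -mulnA mulnCA leq_mul2l hK.
Qed.

(** Cauchy-Schwarz for the splitting [x ^ 2 * y ^ 4 = (x ^ 2 * y) * y ^ 3]. *)
Lemma mean_cauchy_schwarz (x y : Om -> R) :
  mean (fun p => x p ^+ 2 * y p ^+ 4) ^+ 2
    <= mean (fun p => x p ^+ 4 * y p ^+ 2) * mean (fun p => y p ^+ 6).
Proof.
have := sum_cauchy_schwarz (fun p => x p ^+ 2 * y p) (fun p => y p ^+ 3) w_ge0.
by congr (_ ^+ 2 <= _ * _); apply: eq_bigr => p _; congr (_ * _); ring.
Qed.

(** The exchange of exponents: by [mean_cauchy_schwarz] the new constant may be the geometric mean
    of the old one, [Z], and of the linear one, [W]. *)
Lemma bilinear_swap D i1 i2 Z W Y : 0 <= Y -> 0 <= W -> Z * W <= Y ^+ 2 ->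
  (forall r, mean (fun p => size_block i2 r p ^+ 6) <= W * mass i2 r ^+ 3) ->
  bilinear_bound D i2 i1 Z -> bilinear_bound D i1 i2 Y.
Proof.
move=> Y0 W0 ZWY hW hZ r1 r2 sep.
have S1 := mass_ge0 i1 r1; have S2 := mass_ge0 i2 r2.
rewrite -[leLHS]ger0_norm ?mean_ge0//; last first.
  by move=> p; rewrite mulr_ge0 ?exprn_ge0 ?size_block_ge0.
rewrite -[leRHS]ger0_norm; last by rewrite mulr_ge0// mulr_ge0// exprn_ge0.
rewrite -ler_sqr ?nnegrE// !real_normK ?num_real//.
apply: le_trans (mean_cauchy_schwarz _ _) _.
have := hZ r2 r1 (separated_sym sep).
under [X in X <= _ -> _]eq_bigr => p _ do rewrite [X in _ * X]mulrC.
move=> h.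
apply: (@le_trans _ _ ((Z * (mass i2 r2 * mass i1 r1 ^+ 2)) * (W * mass i2 r2 ^+ 3))).
  by apply: ler_pM => //; apply: mean_ge0 => p; rewrite ?mulr_ge0 ?exprn_ge0 ?size_block_ge0.
rewrite [leLHS](_ : _ = (Z * W) * (mass i1 r1 * mass i2 r2 ^+ 2) ^+ 2); last by ring.
by rewrite [leRHS]exprMn ler_wpM2r ?sqr_ge0.
Qed.

(** Hoelder with exponents 3 and 3/2, obtained from two applications of Cauchy-Schwarz:
    [x ^ 2 <= y * v] and [y ^ 2 <= x * u] give [x ^ 4 <= x * u * v ^ 2]. *)
Lemma bilinear_trivial D i1 i2 W : 0 <= W ->
  (forall r, mean (fun p => size_block i1 r p ^+ 6) <= W * mass i1 r ^+ 3) ->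
  (forall r, mean (fun p => size_block i2 r p ^+ 6) <= W * mass i2 r ^+ 3) ->
  bilinear_bound D i1 i2 W.
Proof.
move=> W0 h1 h2 r1 r2 _.
have S1 := mass_ge0 i1 r1; have S2 := mass_ge0 i2 r2.
have c1 := mean_cauchy_schwarz (size_block i1 r1) (size_block i2 r2).
have := mean_cauchy_schwarz (size_block i2 r2) (size_block i1 r1).
under [X in X ^+ 2 <= _ -> _]eq_bigr => p _ do rewrite [X in _ * X]mulrC.
under [X in _ <= X * _ -> _]eq_bigr => p _ do rewrite [X in _ * X]mulrC.
move=> c2; move: c1 c2 (h1 r1) (h2 r2).
set x := mean (fun p => _ ^+ 2 * _ ^+ 4); set y := mean (fun p => _ ^+ 4 * _ ^+ 2).
set u := mean (fun p => size_block i1 _ _ ^+ 6).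
set v := mean (fun p => size_block i2 _ _ ^+ 6).
have x0 : 0 <= x by apply: mean_ge0 => p; rewrite mulr_ge0 ?exprn_ge0 ?size_block_ge0.
have y0 : 0 <= y by apply: mean_ge0 => p; rewrite mulr_ge0 ?exprn_ge0 ?size_block_ge0.
have u0 : 0 <= u by apply: mean_ge0 => p; rewrite exprn_ge0 ?size_block_ge0.
have v0 : 0 <= v by apply: mean_ge0 => p; rewrite exprn_ge0 ?size_block_ge0.
rewrite -/x -/y => c1 c2 hu hv.
have [->|xn0] := eqVneq x 0; first by rewrite mulr_ge0// mulr_ge0// exprn_ge0.
have xp : 0 < x by rewrite lt_neqAle eq_sym xn0.
have : x ^+ 4 <= x * u * v ^+ 2.
  rewrite (_ : 4%N = (2 * 2)%N)// exprM.
  apply: (@le_trans _ _ ((y * v) ^+ 2)); first by rewrite ler_sqr ?nnegrE ?mulr_ge0 ?sqr_ge0.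
  by rewrite exprMn ler_wpM2r ?sqr_ge0.
rewrite exprS -mulrA ler_pM2l// => x3.
rewrite -(@ler_pXn2r _ 3)// ?nnegrE ?mulr_ge0 ?exprn_ge0//.
apply: le_trans x3 _.
apply: (@le_trans _ _ ((W * mass i1 r1 ^+ 3) * (W * mass i2 r2 ^+ 3) ^+ 2)).
  by rewrite ler_pM ?sqr_ge0// ler_sqr// nnegrE// mulr_ge0 ?exprn_ge0.
by rewrite le_eqVlt; apply/orP; left; apply/eqP; ring.
Qed.

Lemma bilinear_le D i1 i2 Z Y : Z <= Y -> bilinear_bound D i1 i2 Z -> bilinear_bound D i1 i2 Y.
Proof.
move=> ZY h r1 r2 /h H; apply: le_trans H _.
by rewrite ler_wpM2r// mulr_ge0 ?exprn_ge0 ?mass_ge0.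
Qed.

(** A whole block of length [K ^ j] lies between two blocks that are neither equal nor adjacent. *)
Lemma separated_far j r s : ~~ near_ord 1 r s -> separated (K ^ j) j r j s.
Proof.
move=> far.
have Ki0 : (0 < K ^ j)%N by rewrite expn_gt0 K_gt0.
have aux m m' : ((m' %/ K ^ j) + 1 < m %/ K ^ j)%N -> (m' + K ^ j <= m)%N.
  move=> lt; have h1 := ltn_ceil m' Ki0; have h2 := leq_divM m (K ^ j).
  apply: leq_trans h2; apply: (@leq_trans ((m' %/ K ^ j).+1 * K ^ j + K ^ j)%N).
    by rewrite leq_add2r ltnW.
  by rewrite addnC -mulSn leq_mul2r -[X in (X < _)%N]addn1 lt orbT.
move: far; rewrite /near_ord negb_and -!ltnNge => /orP[h|h].
  by left => k l kr ls; apply: aux; rewrite kr ls.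
by right => k l kr ls; apply: aux; rewrite kr ls.
Qed.

(** * Induction on scales *)

Section Iteration.
Variables (U n : nat).
(** The loss allowed per scale is [U ^ 2], and each term of the broad-narrow dichotomy may use half
    of it. [U_large] pays for the factor [4 ^ 6] of the narrow term; [n_large] lets the gain
    [U ^ - n] absorb the [K ^ 8] of the broad term together with the constants [19 K] of almost
    orthogonality and [38 K] of the iteration. *)
Hypothesis U_large : 2 * 4 ^+ 6 <= U%:R ^+ 2 :> R.
Hypothesis n_large : 2 * (19 * 38) * K%:R ^+ 10 <= U%:R ^+ n :> R.

Local Notation T := (U%:R ^+ 2 : R).

Let U_ge1 : 1 <= U%:R :> R.
Proof.
have : (0 < U)%N by rewrite lt0n; apply/eqP => U0; move: U_large; rewrite U0 expr0n/=; lra.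
by rewrite ler1n.
Qed.

Let U_gt0 : 0 < U%:R :> R. Proof. exact: lt_le_trans U_ge1. Qed.

Let K_ge1 : 1 <= K%:R :> R. Proof. by rewrite ler1n. Qed.

Let near_const : (9 * K).*2.+1%:R <= 19 * K%:R :> R.
Proof. by rewrite -natrM ler_nat; move: K_gt0; lia. Qed.

(* The gain [U ^ - (2 ^ m * (n - m))] solves the recursion
   [y m ^ 2 = (19 K) T ^ - (2 ^ m) * y (m + 1)] up to constants. *)
Lemma bilinear_iterate j C m : 0 <= C -> (m <= n)%N -> (2 ^ n.+1 <= j.+1)%N ->
    (forall i r, (i <= j)%N ->
      mean (fun p => size_block i r p ^+ 6) <= C * T ^+ i * mass i r ^+ 3) ->
  bilinear_bound (K ^ j) (j.+1 - 2 ^ m.+1) (j.+1 - 2 ^ m)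
    (C * T ^+ j.+1 * (38 * K%:R / U%:R ^+ (2 ^ m * (n - m)))).
Proof.
move=> C0 mn hj hC; have [d dn] : exists d, n = (m + d)%N by exists (n - m)%N; rewrite subnKC.
(* The induction descends from [m = n], where the claimed gain is [U ^ 0] and the trivial bilinear
   bound is enough. *)
elim: d m dn {mn} => [|d ih] m dn.
  have T1 : 1 <= T by rewrite exprn_ege1.
  have le_lvl i r : (i <= j)%N ->
      mean (fun p => size_block i r p ^+ 6) <= (C * T ^+ j.+1) * mass i r ^+ 3.
    move=> ij; apply: le_trans (hC i r ij) _.
    rewrite ler_wpM2r ?exprn_ge0 ?mass_ge0// ler_wpM2l//.
    by apply: ler_weXn2l => //; exact: leqW.
  have CT : 0 <= C * T ^+ j.+1 by rewrite mulr_ge0// exprn_ge0// exprn_ge0// ltW.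
  apply: (@bilinear_le _ _ _ (C * T ^+ j.+1)).
    rewrite ler_peMr// dn addn0 subnn muln0 expr0 divr1.
    by move: K_ge1; lra.
  apply: bilinear_trivial => // r; apply: le_lvl.
    by rewrite leq_subLR -ltnS -addnS addnC -ltn_subLR ?subnn ?expn_gt0// leq_addr.
  by rewrite leq_subLR -ltnS -addnS addnC -ltn_subLR ?subnn ?expn_gt0// leq_addr.
have {ih} := ih m.+1 (etrans dn (esym (addSnnS _ _))).
set b := (2 ^ m)%N.
have b0 : (0 < b)%N by rewrite expn_gt0.
have bj : (4 * b <= j.+1)%N.
  apply: leq_trans hj; rewrite (_ : 4 = 2 ^ 2)%N// -expnD leq_exp2l//.
  by rewrite dn; clear; lia.
have -> : (2 ^ m.+1 = 2 * b)%N by rewrite expnS.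
have -> : (2 ^ m.+2 = 4 * b)%N by rewrite !expnS mulnA.
have -> : (n - m.+1 = d)%N by rewrite dn; clear; lia.
have -> : (n - m = d.+1)%N by rewrite dn; clear; lia.
(* Almost orthogonality raises the first block from level [j + 1 - 4 b] to [j + 1 - b], the other
   one staying at [j + 1 - 2 b]: the condition on the levels holds with equality. The exchange then
   puts the two blocks in the order required for [m], at the cost of the linear estimate at level
   [j + 1 - b]. *)
move=> /(@bilinear_refine j _ _ (3 * b)).
have -> : (j.+1 - 4 * b + 3 * b = j.+1 - b)%N by clear -bj; lia.
have lvl : ((j.+1 - 2 * b).*2 <= j.+1 + (j.+1 - 4 * b))%N by clear -bj; lia.
move=> /(_ lvl); apply: bilinear_swap (hC _ ^~ _); last by clear -bj b0; lia.
- by rewrite mulr_ge0 ?mulr_ge0 ?exprn_ge0 ?invr_ge0 ?exprn_ge0 ?ler0n.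
- by rewrite mulr_ge0 ?exprn_ge0.
have T0 : 0 < T by rewrite exprn_gt0.
set D := _.*2.+1%:R.
have -> : T ^+ j.+1 = T ^+ (j.+1 - b) * T ^+ b by rewrite -exprD subnK//; clear -bj; lia.
set t := T ^+ (j.+1 - b).
have t0 : 0 < t by rewrite exprn_gt0.
have -> : T ^+ b = U%:R ^+ (2 * b) by rewrite -exprM.
have -> : (b * d.+1 = b * d + b)%N by rewrite mulnS addnC.
have -> : (2 * b * d = b * d * 2)%N by rewrite -mulnA mulnC.
rewrite [(2 * b)%N]mulnC exprD !exprM.
set u := U%:R ^+ b; set y := u ^+ d.
have u0 : 0 < u by rewrite exprn_gt0.
have y0 : 0 < y by rewrite exprn_gt0.
(* Both sides carry the square of [C * t * u / y], so all powers of [U] match; what remains is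
   [D <= 38 K]. *)
rewrite [leLHS](_ : _ = (C * t * u / y) ^+ 2 * (D * (38 * K%:R))); last first.
  by field; rewrite !gt_eqF.
rewrite [leRHS](_ : _ = (C * t * u / y) ^+ 2 * (38 * K%:R) ^+ 2); last first.
  by field; rewrite !gt_eqF.
rewrite ler_wpM2l ?sqr_ge0// expr2 ler_wpM2r ?mulr_ge0 ?ler0n//.
by apply: le_trans near_const _; move: K_ge1; lra.
Qed.

(* Broad-narrow analysis reduces to pairs of separated blocks at level [j], where
   the iterated bilinear bound wins [U ^ - n] against a fixed power of [K]. *)
Lemma block_step j C : 0 <= C -> (2 ^ n.+1 <= j.+1)%N ->
    (forall i r, (i <= j)%N ->
      mean (fun p => size_block i r p ^+ 6) <= C * T ^+ i * mass i r ^+ 3) ->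
  forall r, mean (fun p => size_block j.+1 r p ^+ 6) <= C * T ^+ j.+1 * mass j.+1 r ^+ 3.
Proof.
move=> C0 hj hC r.
have Un0 : 0 < U%:R ^+ n :> R by rewrite exprn_gt0.
have T0 : 0 < T by rewrite exprn_gt0.
have j1 : (1 < j.+1)%N by apply: leq_trans hj; rewrite -[2%N]expn1 leq_exp2l.
(* For [m = 0] the levels are [j - 1] and [j], with gain [U ^ - n]; one more use of almost
   orthogonality brings both blocks to level [j]. *)
have := bilinear_iterate C0 (leq0n n) hj hC.
rewrite subn0 !expn0 mul1n expn1 subn1/=.
move=> /(@bilinear_refine j _ _ 1); rewrite addn1.
have -> : (j.+1 - 2).+1 = j by clear -j1; lia.
have lvl : (j.*2 <= j.+1 + (j.+1 - 2))%N by clear; lia.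
move=> /(_ lvl) hB.
set B := _ * (_ * _) in hB.
pose P : pred 'I_Q := fun s => (s %/ K ^ 1)%N == r.
apply: (@le_trans _ _ (mean (fun p => 4 ^+ 6 * \sum_(s | P s) size_block j s p ^+ 6
   + K%:R ^+ 8 * \sum_(s | P s) \sum_(s' | P s' && ~~ near_ord 1 s s')
       size_block j s p ^+ 2 * size_block j s' p ^+ 4))).
  apply: ler_mean => p.
  apply: le_trans (broad_narrow (fun s : 'I_Q => size_block_ge0 j s p) _); last first.
    by have := card_block 1 r; rewrite expn1.
  rewrite ler_pXn2r// ?nnegrE ?size_block_ge0// ?sumr_ge0//; last first.
    by move=> s _; exact: size_block_ge0.
  by rewrite /size_block -[j.+1]addn1 block_split; exact: normc_sum.
rewrite meanD !meanZ !mean_sum.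
under [X in _ + _ * X <= _]eq_bigr => s _ do rewrite mean_sum.
have sumP : mass j.+1 r = \sum_(s | P s) mass j s by rewrite -[j.+1]addn1 mass_split.
have Ps_le s : P s -> mass j s <= mass j.+1 r.
  move=> Ps; rewrite sumP (bigD1 s)//= lerDl sumr_ge0// => s' _; exact: mass_ge0.
have S0 := mass_ge0 j.+1 r.
have narrow : \sum_(s | P s) mean (fun p => size_block j s p ^+ 6)
    <= C * T ^+ j * mass j.+1 r ^+ 3.
  apply: (@le_trans _ _ (\sum_(s | P s) C * T ^+ j * (mass j s * mass j.+1 r ^+ 2))).
    apply: ler_sum => s Ps; apply: le_trans (hC _ _ (leqnn _)) _.
    rewrite ler_wpM2l// ?mulr_ge0 ?exprn_ge0 ?ler0n// exprS.
    by rewrite ler_wpM2l ?mass_ge0// ler_pXn2r ?Ps_le// nnegrE mass_ge0.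
  by rewrite -mulr_sumr -mulr_suml -sumP -exprS.
have B0 : 0 <= B.
  by rewrite /B !mulr_ge0 ?ler0n ?exprn_ge0 ?invr_ge0 ?exprn_ge0 ?ler0n.
have broad : \sum_(s | P s) \sum_(s' | P s' && ~~ near_ord 1 s s')
    mean (fun p => size_block j s p ^+ 2 * size_block j s' p ^+ 4)
    <= B * mass j.+1 r ^+ 3.
  apply: (@le_trans _ _ (\sum_(s | P s) \sum_(s' | P s')
      B * (mass j s * (mass j s' * mass j.+1 r)))).
    apply: ler_sum => s Ps; rewrite [leRHS](bigID (fun s' : 'I_Q => near_ord 1 s s'))/=.
    rewrite -[leLHS]add0r lerD//.
      by apply: sumr_ge0 => s' _; rewrite mulr_ge0// mulr_ge0 ?mass_ge0// mulr_ge0 ?mass_ge0.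
    apply: ler_sum => s' /andP[Ps' /separated_far sep].
    apply: le_trans (hB _ _ (sep j)) _.
    by rewrite ler_wpM2l// ler_wpM2l ?mass_ge0// expr2 ler_wpM2l ?mass_ge0// Ps_le.
  rewrite le_eqVlt; apply/orP; left; apply/eqP.
  under eq_bigr => s _ do rewrite -mulr_sumr -mulr_sumr -mulr_suml -sumP.
  by rewrite -mulr_sumr -mulr_suml -sumP; ring.
apply: (@le_trans _ _ (4 ^+ 6 * (C * T ^+ j * mass j.+1 r ^+ 3)
    + K%:R ^+ 8 * (B * mass j.+1 r ^+ 3))).
  by rewrite lerD// ler_wpM2l ?exprn_ge0 ?ler0n.
rewrite (_ : _ + _ = (4 ^+ 6 * C * T ^+ j + K%:R ^+ 8 * B) * mass j.+1 r ^+ 3); last by ring.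
rewrite ler_wpM2r ?exprn_ge0//.
have CT0 : 0 <= C * T ^+ j by rewrite mulr_ge0// exprn_ge0// ltW.
(* The narrow and the broad term each take half of the target: the first by [U_large], the second by
   [n_large]. *)
have h1 : 2 * (4 ^+ 6 * C * T ^+ j) <= C * T ^+ j.+1.
  rewrite [T ^+ j.+1]exprS [leRHS]mulrCA.
  by rewrite [leLHS](_ : _ = 2 * 4 ^+ 6 * (C * T ^+ j)) ?ler_wpM2r//; ring.
have h2 : 2 * (K%:R ^+ 8 * B) <= C * T ^+ j.+1.
  have CTj : 0 <= C * T ^+ j.+1 by rewrite mulr_ge0// exprn_ge0// ltW.
  apply: (@le_trans _ _ (2 * (K%:R ^+ 8 *
      (19 * K%:R * (C * T ^+ j.+1 * (38 * K%:R / U%:R ^+ n)))))).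
    rewrite /B; do 2 (rewrite ler_wpM2l ?exprn_ge0 ?ler0n//).
    by rewrite ler_wpM2r// !mulr_ge0 ?ler0n ?invr_ge0 ?exprn_ge0 ?ler0n.
  rewrite [leLHS](_ : _ = C * T ^+ j.+1 * ((2 * (19 * 38) * K%:R ^+ 10) / U%:R ^+ n)); last first.
    by field; rewrite gt_eqF.
  by rewrite ler_piMr// ler_pdivrMr// mul1r.
lra.
Qed.

(** The prefactor is the trivial loss on the scales below [2 ^ (n + 1)], which are too few for [n]
    exchanges; from there on [block_step] propagates the bound without changing it. *)
Theorem block_decoupling j r :
  mean (fun p => size_block j r p ^+ 6)
    <= (K%:R ^+ (3 * 2 ^ n.+1)) * T ^+ j * mass j r ^+ 3.
Proof.
elim/ltn_ind: j r => -[|j] ih r.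
  apply: le_trans (mean_block6_trivial _ _) _; rewrite expn0 expr1n expr0 mulr1.
  by rewrite ler_wpM2r ?exprn_ge0 ?mass_ge0// exprn_ege1.
have [hj|hj] := leqP (2 ^ n.+1) j.+1.
  apply: (block_step _ hj) => [|i s ij]; first by rewrite exprn_ge0.
  by apply: ih; rewrite ltnS.
apply: le_trans (mean_block6_trivial _ _) _.
rewrite ler_wpM2r ?exprn_ge0 ?mass_ge0//.
rewrite natrX -exprM -[leLHS]mulr1 ler_pM ?exprn_ge0 ?ler01 ?exprn_ege1//.
by apply: ler_weXn2l => //; rewrite mulnC leq_mul2l/= ltnW.
Qed.

End Iteration.

End Blocks.

End Decoupling.

Lemma discrete_decoupling (R : realType) (eps : R) : 0 < eps ->
  exists C : R, 0 < C /\
    forall (Om : finType) (w : Om -> R) (e : nat -> Om -> R[i]) (a : nat -> R[i]) (N : nat),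
      (forall p, 0 <= w p) -> \sum_p w p <= 1 ->
      (forall k p, Normc.normc (e k p) <= 1) -> (0 < N)%N ->
      (forall k, a k != 0 -> (N <= 2 * k)%N) ->
      orthogonal_off_resonance w e N ->
      mean w (fun p => Normc.normc (\sum_(k < (2 * N).+1) a k * e k p) ^+ 6)
        <= C * N%:R `^ eps * (\sum_(k < (2 * N).+1) Normc.normc (a k) ^+ 2) ^+ 3.
Proof.
move=> eps0.
have [q q0 qeps] : exists2 q : nat, (0 < q)%N & 1 <= q%:R * eps.
  have ei : 0 <= eps^-1 by rewrite invr_ge0 ltW.
  exists (Num.bound eps^-1).
    by rewrite -(ltr_nat R); apply: le_lt_trans (archi_boundP ei).
  by rewrite -ler_pdivrMr// div1r ltW// archi_boundP.
(* With this [K] the loss per scale is [U ^ 2 = K ^ (1/q)], at most [K ^ eps]. Numerically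
   [2 * 4 ^ 6 = 8192 <= 128 ^ 2], and [K ^ 10 = U ^ (20 q)] leaves [U ^ 2] to cover
   [2 * 19 * 38 = 1444]. *)
pose U := 128%N; pose K := (U ^ (2 * q))%N; pose n := (20 * q + 2)%N.
have K1 : (1 < K)%N by rewrite -(expn0 U) ltn_exp2l// muln_gt0.
have K0 : (0 < K)%N by exact: ltnW.
have U_large : 2 * 4 ^+ 6 <= U%:R ^+ 2 :> R by rewrite /U; lra.
have n_large : 2 * (19 * 38) * K%:R ^+ 10 <= U%:R ^+ n :> R.
  rewrite /K /n natrX -exprM addnC exprD (_ : 2 * q * 10 = 20 * q)%N; last by lia.
  by rewrite ler_wpM2r ?exprn_ge0//; rewrite /U; lra.
exists (K%:R ^+ (3 * 2 ^ n.+1) * U%:R ^+ 2 * 2 `^ eps); split.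
  by rewrite !mulr_gt0 ?exprn_gt0 ?powR_gt0 ?ltr0n.
move=> Om w e a N w0 w1 e1 N0 aN orth.
(* The least such exponent: at this level block 0 contains all frequencies, while minimality keeps
   [K ^ j], one level below, at most [2 N]. *)
have exj : exists j, (2 * N < K ^ j)%N by exists (2 * N)%N; exact: ltn_expl.
case: (ex_minnP exj) => -[|j]; first by rewrite expn0 ltnS leqn0 muln_eq0/= => /eqP N00; rewrite N00 in N0.
move=> hj hmin.
have {}hmin : (K ^ j <= 2 * N)%N.
  by rewrite leqNgt; apply/negP => /hmin; rewrite ltnn.
have := block_decoupling w0 w1 e1 N0 aN orth K0 U_large n_large j.+1 0.
have full (V : nmodType) (F : nat -> V) : \sum_(k < (2 * N).+1 | (k %/ K ^ j.+1)%N == 0%N) F k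
    = \sum_(k < (2 * N).+1) F k.
  by apply: eq_bigl => k; rewrite divn_small ?eqxx// (leq_trans _ hj)// ltn_ord.
rewrite /mass (full _ (fun k => Normc.normc (a k) ^+ 2)).
rewrite /mean/size_block/block.
under eq_bigr => p _ do rewrite (full _ (fun k => a k * e k p)).
move=> h; apply: le_trans h _.
rewrite ler_wpM2r ?exprn_ge0 ?sumr_ge0// => [k _|]; first by rewrite exprn_ge0 ?normc_ge0.
rewrite exprS !mulrA -[leRHS]mulrA ler_wpM2l ?mulr_ge0 ?exprn_ge0//.
set G := _ ^+ j.
have G1 : 1 <= G by rewrite /G -exprM exprn_ege1// ler1n.
have G0 : 0 <= G by apply: le_trans G1.
(* Here [G ^ q = K ^ j <= 2 N], so that [G <= (G ^ q) ^ eps <= (2 N) ^ eps]. *)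
apply: (@le_trans _ _ (G `^ (q%:R * eps))).
  by rewrite -[leLHS]powRr1// ler_powR.
rewrite powRrM powR_mulrn// -powRM ?ler0n//.
apply: ge0_ler_powR; rewrite ?nnegrE ?mulr_ge0 ?exprn_ge0 ?ler0n ?(ltW eps0)//.
rewrite /G -!exprM -natrM -natrX ler_nat; apply: leq_trans hmin.
by rewrite /K -expnM leq_exp2l//; lia.
Qed.

(** * Waves on a grid and the Fejer kernel *)

Section Waves.
Context {R : realType}.
Implicit Types (x t : R) (m n : int).

Lemma expiD x t : expi (x + t) = expi x * expi t.
Proof.
apply/eqP; rewrite eq_complex /= cosD sinD addrC; apply/andP; split; apply/eqP; ring.
Qed.

Lemma expiN x : expi (- x) = ((expi x)^*)%C.
Proof. by rewrite /expi cosN sinN. Qed.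

Lemma normc_expi x : Normc.normc (expi x) = 1.
Proof. by rewrite /= cos2Dsin2 sqrtr1. Qed.

Lemma expi0 : expi (0 : R) = 1.
Proof. by rewrite /expi cos0 sin0. Qed.

Lemma expi_natr x (k : nat) : expi (x * k%:R) = expi x ^+ k.
Proof.
elim: k => [|k ih]; first by rewrite mulr0 expi0 expr0.
by rewrite -natr1 mulrDr mulr1 expiD ih exprSr.
Qed.

Lemma expi_period m : expi (m%:~R * (2 * pi : R)) = 1.
Proof.
have e1 : expi (2 * pi : R) = 1 by rewrite /expi mulrC mulr_natr cos2pi sin2pi.
case: m => k; first by rewrite mulrC -pmulrn expi_natr e1 expr1n.
by rewrite NegzE mulrNz mulNr expiN mulrC -pmulrn expi_natr e1 expr1n rmorph1.
Qed.

Lemma expi_neq1 x : 0 < x -> x < 2 * pi -> expi x != 1.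
Proof.
move=> x0 x2; apply/eqP => -[c1 _].
have s0 : 0 < sin (x / 2).
  by apply: sin_gt0_pi; rewrite divr_gt0//= ltr_pdivrMr// mulrC.
have := cosD (x / 2) (x / 2); rewrite -splitr c1 => h.
have := cos2Dsin2 (x / 2); nra.
Qed.

(** The offset [x] is kept free: integrating over it later turns grid sums into integrals without
    error. *)
Definition grid_pt (P : nat) x (i : nat) : R := x + 2 * pi / P%:R * i%:R.

(** A geometric sum whose ratio is a [P]-th root of unity, different from 1 because
    [0 < |m| < P]. *)
Lemma sum_expi_grid_eq0 (P : nat) x m : m != 0 -> (`|m| < P)%N ->
  \sum_(i < P) expi (m%:~R * grid_pt P x i) = 0.
Proof.
move=> m0 mP; have P0 : (0 < P)%N by apply: leq_ltn_trans mP.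
have PR : 0 < P%:R :> R by rewrite ltr0n.
pose z : R[i] := expi (m%:~R * (2 * pi / P%:R)).
rewrite (_ : \sum_(i < P) _ = expi (m%:~R * x) * \sum_(i < P) z ^+ i).
  have zP : z ^+ P - 1 = 0.
    rewrite -expi_natr -[X in expi X]mulrA divfK ?gt_eqF// expi_period; exact: subrr.
  move: zP; rewrite subrX1 => /eqP; rewrite mulf_eq0 => /orP[|/eqP ->]; last by rewrite mulr0.
  rewrite subr_eq0 => /eqP z1; exfalso.
  have [y [y0 y2 ey]] : exists y, [/\ 0 < y, y < 2 * pi & expi (y : R) = 1].
    have main k : (0 < k < P)%N -> 0 < k%:R * (2 * pi / P%:R) :> R /\ k%:R * (2 * pi / P%:R) < 2 * pi :> R.
      move=> /andP[k0 kP]; have pi2 : 0 < 2 * pi :> R by rewrite mulr_gt0 ?pi_gt0.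
      split; first by rewrite mulr_gt0 ?divr_gt0 ?ltr0n.
      by rewrite [X in X < _]mulrA ltr_pdivrMr// [X in X < _]mulrC ltr_pM2l// ltr_nat.
    exists (`|m|%N%:R * (2 * pi / P%:R)).
    have [|h1 h2] := main `|m|%N; first by rewrite absz_gt0 m0.
    split=> //; move: z1; rewrite /z; case: (m) => k; first by rewrite -pmulrn.
    by rewrite NegzE mulrNz mulNr expiN abszN -pmulrn => /(congr1 (fun z => conjc z)); rewrite conjcK rmorph1.
  by have := expi_neq1 y0 y2; rewrite ey eqxx.
rewrite mulr_sumr; apply: eq_bigr => i _.
by rewrite /grid_pt mulrDr expiD mulrA expi_natr.
Qed.

Lemma sum_expi_grid0 (P : nat) x : \sum_(i < P) expi (0%:~R * grid_pt P x i) = P%:R.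
Proof. by under eq_bigr do rewrite mul0r expi0; rewrite sumr_const card_ord. Qed.

Definition wave m n x t : R[i] := expi (m%:~R * x - n%:~R * t).

Lemma waveM m n m' n' x t : wave m n x t * wave m' n' x t = wave (m + m') (n + n') x t.
Proof. by rewrite /wave -expiD; congr expi; rewrite !intrD; ring. Qed.

Lemma conjc_wave m n x t : ((wave m n x t)^*)%C = wave (- m) (- n) x t.
Proof. by rewrite /wave -expiN; congr expi; rewrite !mulrNz; ring. Qed.

Lemma wave_split m n x t : wave m n x t = expi (m%:~R * x) * expi ((- n)%:~R * t).
Proof. by rewrite /wave mulrNz mulNr expiD. Qed.

(** The Fejer kernel with mean 1. It is nonnegative, has only frequencies below [M] in modulus, and
    is of size [M] on [[0, 1/M]], so it can replace the sharp time cutoff in upper bounds. *)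
Definition fejer (M : nat) t : R :=
  M%:R^-1 * Normc.normc (\sum_(j < M) expi (j%:R * t)) ^+ 2.

Lemma fejer_ge0 M t : 0 <= fejer M t.
Proof. by rewrite mulr_ge0 ?invr_ge0 ?ler0n ?sqr_ge0. Qed.

Lemma fejerE M t : ((fejer M t)%:C)%C =
  ((M%:R^-1)%:C)%C * \sum_(a < M) \sum_(b < M) expi ((a%:Z - b%:Z)%:~R * t).
Proof.
rewrite rmorphM/=; congr (_ * _); rewrite -mulcJ rmorph_sum/= mulr_suml.
apply: eq_bigr => a _; rewrite mulr_sumr; apply: eq_bigr => b _.
rewrite [X in _ * X](_ : _ = expi (- (b%:R * t))); last by rewrite expiN.
by rewrite -expiD; congr expi; rewrite intrB -!pmulrn; ring.
Qed.

Lemma sum_fejer_grid (P M : nat) t n :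
  \sum_(j < P) ((fejer M (grid_pt P t j))%:C)%C * expi (n%:~R * grid_pt P t j)
  = ((M%:R^-1)%:C)%C * \sum_(a < M) \sum_(b < M)
      \sum_(j < P) expi ((a%:Z - b%:Z + n)%:~R * grid_pt P t j).
Proof.
under eq_bigr => j _ do rewrite fejerE -mulrA mulr_suml.
rewrite -mulr_sumr; congr (_ * _); rewrite exchange_big/=; apply: eq_bigr => a _.
under eq_bigr => j _ do rewrite mulr_suml.
rewrite exchange_big/=; apply: eq_bigr => b _; apply: eq_bigr => j _.
by rewrite -expiD; congr expi; rewrite [in RHS]intrD mulrDl.
Qed.

(** The frequencies [a - b] of the kernel stay below [M] in modulus, hence cannot cancel [n], and
    the grid is fine enough to avoid aliasing. *)
Lemma sum_fejer_grid_eq0 (P M : nat) t n : (M <= `|n|)%N -> (`|n| + M <= P)%N ->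
  \sum_(j < P) ((fejer M (grid_pt P t j))%:C)%C * expi (n%:~R * grid_pt P t j) = 0.
Proof.
move=> Mn nP; rewrite sum_fejer_grid big1 ?mulr0// => a _; rewrite big1// => b _.
have aM := ltn_ord a; have bM := ltn_ord b.
by apply: sum_expi_grid_eq0; lia.
Qed.

Lemma sum_fejer_grid1 (P M : nat) t : (0 < M <= P)%N ->
  \sum_(j < P) fejer M (grid_pt P t j) = P%:R.
Proof.
move=> /andP[M0 MP]; have := sum_fejer_grid P M t 0.
under eq_bigr => j _ do rewrite mul0r expi0 mulr1.
rewrite -rmorph_sum/= => h; apply: complexI; rewrite h.
under eq_bigr => a _.
  rewrite (bigD1 a)//= [X in _ + X]big1 ?addr0; last first.
    move=> b ba; have ba' : (b : nat) <> a by move=> ab; case/eqP: ba; exact: val_inj.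
    have aM := ltn_ord a; have bM := ltn_ord b.
    by apply: sum_expi_grid_eq0; lia.
  rewrite subrr sum_expi_grid0; over.
rewrite /= sumr_const card_ord fmorphV !rmorph_nat/= -[X in _ * X]mulr_natl mulrA.
by rewrite mulVf ?mul1r// pnatr_eq0 -lt0n.
Qed.

End Waves.

Definition airy_sum (R : realType) (N : nat) (a : nat -> R[i]) (x t : R) : R[i] :=
  \sum_(k < (2 * N).+1) a k * wave k%:Z (k%:Z ^+ 3) x t.

(* With [32 * N ^ 3] points in each variable the grid is fine enough to see all
   the frequencies that occur: its sums are exact averages over the torus. *)
Lemma grid_orthogonal_off_resonance (R : realType) (N M P : nat) (x t : R) :
    (0 < M <= N)%N -> P = (32 * N ^ 3)%N ->
  orthogonal_off_resonance
    (fun p : 'I_P * 'I_P => P%:R ^- 2 * fejer M (grid_pt P t p.2))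
    (fun k p => wave k%:Z (k%:Z ^+ 3) (grid_pt P x p.1) (grid_pt P t p.2)) N.
Proof.
move=> /andP[M0 MN] PE k l1 l2 k' l3 l4 hk h1 h2 hk' h3 h4 res.
have N0 : (0 < N)%N by apply: leq_trans MN.
have N3 : (N <= N ^ 3)%N by rewrite -[leqLHS]expn1 leq_pexp2l.
pose m := k%:Z + l1%:Z + l2%:Z - k'%:Z - l3%:Z - l4%:Z.
pose n := k%:Z ^+ 3 + l1%:Z ^+ 3 + l2%:Z ^+ 3 - k'%:Z ^+ 3 - l3%:Z ^+ 3 - l4%:Z ^+ 3.
(* The mean factors into a space sum that detects [m] and a weighted time sum that detects [n]. *)
transitivity (((P%:R ^- 2)%:C)%C * ((\sum_(i < P) expi (m%:~R * grid_pt P x i)) *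
   \sum_(j < P) ((fejer M (grid_pt P t j))%:C)%C * expi ((- n)%:~R * grid_pt P t j))).
  rewrite mulr_suml mulr_sumr.
  under [RHS]eq_bigr => i _ do rewrite mulr_sumr mulr_sumr.
  rewrite [RHS]pair_bigA; apply: eq_bigr => p _; cbv beta.
  have realcM (u v : R) : ((u * v)%:C)%C = ((u%:C)%C * (v%:C)%C) by rewrite rmorphM.
  rewrite !waveM conjc_wave waveM wave_split realcM -!mulrA; congr (_ * _).
  rewrite mulrCA; congr (expi (_ * _) * (_ * expi (_ * _))).
    by congr (_%:~R); rewrite /m; ring.
  by congr (_%:~R); rewrite /n; ring.
have cube u : (u <= 2 * N)%N -> 0 <= u%:Z ^+ 3 <= 8 * (N ^ 3)%N%:Z.
  move=> hu; rewrite exprn_ge0//= -[u%:Z ^+ 3]/((u ^ 3)%N%:Z).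
  have : (u ^ 3 <= (2 * N) ^ 3)%N by rewrite leq_exp2r.
  by rewrite expnMn; lia.
(* Three cubes of size at most [8 N ^ 3] on each side; with [M <= N] this stays below
   [P = 32 N ^ 3]. *)
have nb : `|n| <= 24 * (N ^ 3)%N%:Z.
  move: (cube _ hk) (cube _ h1) (cube _ h2) (cube _ hk') (cube _ h3) (cube _ h4).
  by rewrite /n; clear; lia.
have [m0|m0] := eqVneq m 0; last first.
  rewrite sum_expi_grid_eq0 ?mul0r ?mulr0//.
  by rewrite PE; move: hk h1 h2 hk' h3 h4 N3 N0; rewrite /m; clear; lia.
rewrite sum_fejer_grid_eq0 ?mulr0//; last first.
  by rewrite PE; move: nb N3 MN; clear; lia.
rewrite leqNgt; apply/negP => nM; apply: res; split.
  by move: m0; rewrite /m; clear; lia.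
by rewrite -/n; move: nM MN; clear; lia.
Qed.

Lemma grid_decoupling (R : realType) (eps : R) : 0 < eps ->
  exists C : R, 0 < C /\
    forall (N M P : nat) (a : nat -> R[i]) (x t : R), (0 < M <= N)%N ->
      (forall k, a k != 0 -> (N <= 2 * k)%N) ->
      P = (32 * N ^ 3)%N ->
      \sum_(j < P) \sum_(i < P) fejer M (grid_pt P t j)
          * Normc.normc (airy_sum N a (grid_pt P x i) (grid_pt P t j)) ^+ 6
        <= P%:R ^+ 2 * (C * N%:R `^ eps
          * (\sum_(k < (2 * N).+1) Normc.normc (a k) ^+ 2) ^+ 3).
Proof.
move=> /discrete_decoupling[C [C0 hC]]; exists C; split=> // N M P a x t MN aN PE.
have /andP[M0 MN'] := MN.
have N0 : (0 < N)%N by apply: leq_trans MN'.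
have P0 : (0 < P)%N by rewrite PE muln_gt0/= expn_gt0 N0.
have PR : 0 < P%:R :> R by rewrite ltr0n.
pose w (p : 'I_P * 'I_P) := P%:R ^- 2 * fejer M (grid_pt P t p.2).
have w0 p : 0 <= w p by rewrite mulr_ge0 ?fejer_ge0 ?invr_ge0 ?exprn_ge0.
have w1 : \sum_p w p <= 1.
  rewrite -(pair_bigA _ (fun i j : 'I_P => P%:R ^- 2 * fejer M (grid_pt P t j)))/=.
  under eq_bigr => i _.
    rewrite -mulr_sumr sum_fejer_grid1; last first.
      rewrite M0/= PE (leq_trans MN')// (@leq_trans (N ^ 3))// ?leq_pmull//.
      by rewrite -[leqLHS]expn1 leq_pexp2l.
    over.
  rewrite sumr_const card_ord -[_ *+ P]mulr_natr -mulrA -[P%:R * _]expr2 mulVf//.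
  by rewrite expf_neq0// gt_eqF.
pose e k (p : 'I_P * 'I_P) := wave k%:Z (k%:Z ^+ 3) (grid_pt P x p.1) (grid_pt P t p.2).
have e1 k p : Normc.normc (e k p) <= 1 by rewrite /e/wave normc_expi.
have := hC _ w e a N w0 w1 e1 N0 aN (grid_orthogonal_off_resonance x t MN PE).
rewrite -(ler_pM2l (exprn_gt0 2 PR)); apply: le_trans.
rewrite /mean exchange_big pair_bigA mulr_sumr.
rewrite le_eqVlt; apply/orP; left; apply/eqP; apply: eq_bigr => p _.
by rewrite /w [RHS]mulrA mulVKf// expf_neq0// gt_eqF.
Qed.

(** * Integrals over the torus *)

Section TorusIntegral.
Context {R : realType}.
Local Notation mu := (@lebesgue_measure R).
Local Open Scope ereal_scope.

Lemma lebesgue_measure_shift (c : R) (A : set R) : measurable A ->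
  pushforward mu ((fun x => x + c)%R : _ -> measurableTypeR R) A = mu A.
Proof.
have mc : measurable_fun setT ((fun x => x + c)%R : R -> measurableTypeR R).
  exact: measurable_funD.
move=> mA; apply/esym/lebesgue_measure_unique => //= _ [[a b]] _ <-.
rewrite /pushforward.
have -> : ((fun x => x + c)%R @^-1` `]a, b]%classic) = `](a - c)%R, (b - c)%R]%classic.
  by apply/seteqP; split => x /=; rewrite !in_itv/= ltrBlDr lerBrDr.
rewrite !lebesgue_measure_itv/= !lte_fin ltrD2r.
by case: ifP => // _; rewrite -!EFinB; congr EFin; ring.
Qed.

Lemma ge0_integral_shift (f : R -> \bar R) (a b c : R) :
  measurable_fun setT f -> (forall x, 0 <= f x) ->
  \int[mu]_(x in `[(a + c)%R, (b + c)%R[) f x = \int[mu]_(x in `[a, b[) f (x + c)%R.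
Proof.
move=> mf f0.
have mc : measurable_fun setT ((fun x => x + c)%R : R -> measurableTypeR R).
  exact: measurable_funD.
rewrite (_ : `[a, b[%classic =
    ((fun x => x + c)%R : R -> measurableTypeR R) @^-1` `[(a + c)%R, (b + c)%R[%classic); last first.
  by apply/seteqP; split => x /=; rewrite !in_itv/= lerD2r ltrD2r.
rewrite -ge0_integral_pushforward//=; last exact: measurable_funS mf.
by apply: eq_measure_integral => //= A mA AS; exact/esym/lebesgue_measure_shift.
Qed.

Lemma ge0_integral_split (f : R -> \bar R) (h : R) (P : nat) :
  (0 <= h)%R -> measurable_fun setT f -> (forall x, 0 <= f x) ->
  \int[mu]_(x in `[0%R, (h * P%:R)%R[) f x
    = \sum_(i < P) \int[mu]_(x in `[0%R, h[) f (x + h * i%:R)%R.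
Proof.
move=> h0 mf f0; elim: P => [|P ih].
  by rewrite big_ord0 mulr0 set_itvco0 integral_set0.
rewrite big_ord_recr/= -ih.
have -> : `[0%R, (h * P.+1%:R)%R[%classic
   = `[0%R, (h * P%:R)%R[%classic `|` `[(h * P%:R)%R, (h * P.+1%:R)%R[%classic :> set R.
  rewrite -itv_bndbnd_setU//= bnd_simp ?mulr_ge0//.
  by rewrite ler_wpM2l// ler_nat.
rewrite ge0_integral_setU//=; last 2 first.
  exact: measurable_funS mf.
  rewrite disj_set2E; apply/eqP; rewrite -subset0 => x /=.
  by rewrite !in_itv/= => -[/andP[_ +] /andP[+ _]]; rewrite ltNge => /negP.
congr (_ + _).
rewrite -(@ge0_integral_shift f 0 h (h * P%:R)%R)//.
by rewrite add0r -natr1 mulrDr mulr1 addrC.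
Qed.

(** The period is cut into [P] cells, all translated onto the first one, so that the variable of
    integration becomes the offset of the grid. *)
Lemma ge0_integral_grid (f : R -> \bar R) (P : nat) : (0 < P)%N ->
  measurable_fun setT f -> (forall x, 0 <= f x) ->
  \int[mu]_(x in `[0%R, (2 * pi)%R[) f x
    = \int[mu]_(x in `[0%R, (2 * pi / P%:R)%R[) \sum_(i < P) f (grid_pt P x i).
Proof.
move=> P0 mf f0; have PR : (0 < P%:R :> R)%R by rewrite ltr0n.
have h0 : (0 <= 2 * pi / P%:R :> R)%R by rewrite divr_ge0// mulr_ge0 ?pi_ge0.
rewrite ge0_integral_sum//=; last first.
  move=> i; apply: (@measurable_funS _ _ _ _ setT) => //.
  by apply: measurableT_comp => //; exact: measurable_funD.
rewrite -ge0_integral_split//; congr (integral mu [set` `[_, _[] _).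
by rewrite divfK// gt_eqF.
Qed.

End TorusIntegral.

(** * From uniform grid bounds to integrals *)

Section TorusAverage.
Context {R : realType}.
Local Notation mu := (@lebesgue_measure R).
Local Open Scope ereal_scope.

Lemma measurable_integral_fst (g : R * R -> R) (D : set R) : measurable D ->
  measurable_fun setT g -> (forall z, 0 <= g z)%R ->
  measurable_fun setT (fun t => \int[mu]_(x in D) (g (x, t))%:E).
Proof.
move=> mD mg g0.
(* The domain [D] is moved into the integrand as an indicator, so that Tonelli's theorem applies on
   the whole plane. *)
pose G (z : measurableTypeR R * measurableTypeR R) : \bar R := (g z * \1_D z.1)%:E.
have mG : measurable_fun setT G.
  apply/measurable_EFinP; apply: measurable_funM => //.
  by apply: measurableT_comp => //; exact: measurable_fst.
have G0 z : 0 <= G z by rewrite lee_fin mulr_ge0.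
have := measurable_fun_fubini_tonelli_G (m1 := mu) G mG G0.
rewrite /fubini_G; congr (measurable_fun _ _); apply/funext => t.
rewrite [RHS]integral_mkcond; apply: eq_integral => x _.
by rewrite /G /= patchE indicE; case: (x \in D); rewrite ?mulr1 ?mulr0.
Qed.

(** Both variables are folded onto one cell of side [2 pi / P]. The hypothesis then bounds the
    integrand at every offset, and the area of the cell cancels the factor [P ^ 2]. *)
Lemma torus_integral_le_grid (g : R * R -> R) (c : R) (P : nat) : (0 < P)%N ->
  measurable_fun setT g -> (forall z, 0 <= g z)%R ->
  (forall x t, \sum_(j < P) \sum_(i < P) g (grid_pt P x i, grid_pt P t j) <= P%:R ^+ 2 * c)%R ->
  \int[mu]_(t in `[0%R, (2 * pi)%R[) \int[mu]_(x in `[0%R, (2 * pi)%R[) (g (x, t))%:E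
    <= ((2 * pi) ^+ 2 * c)%:E.
Proof.
move=> P0 mg g0 gc.
have PR : (0 < P%:R :> R)%R by rewrite ltr0n.
have h0 : (0 < 2 * pi / P%:R :> R)%R by rewrite divr_gt0// mulr_gt0 ?pi_gt0.
have c0 : (0 <= P%:R ^+ 2 * c)%R.
  apply: le_trans (gc 0 0)%R; apply: sumr_ge0 => j _; exact: sumr_ge0.
have msec t : measurable_fun setT (fun x => (g (x, t))%:E).
  by apply/measurable_EFinP; apply: measurableT_comp => //; exact: pair2_measurable.
have sec0 t x : 0 <= (g (x, t))%:E by rewrite lee_fin.
have msecg i t : measurable_fun setT (fun x => (g (grid_pt P x i, t))%:E).
  by apply: (@measurableT_comp _ _ _ _ _ _ (fun x => (g (x, t))%:E)) => //; exact: measurable_funD.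
have mI : measurable_fun setT (fun t => \int[mu]_(x in `[0%R, (2 * pi)%R[) (g (x, t))%:E).
  exact: measurable_integral_fst.
have I0 t : 0 <= \int[mu]_(x in `[0%R, (2 * pi)%R[) (g (x, t))%:E.
  by apply: integral_ge0 => x _; rewrite lee_fin.
rewrite (ge0_integral_grid P0 mI I0).
have bound t : \sum_(j < P) \int[mu]_(x in `[0%R, (2 * pi)%R[) (g (x, grid_pt P t j))%:E
    <= (P%:R ^+ 2 * c * (2 * pi / P%:R))%:E.
  under eq_bigr => j _ do rewrite (ge0_integral_grid P0 (msec _) (sec0 _)).
  rewrite -ge0_integral_sum//=; last 2 first.
    move=> j; apply: (@measurable_funS _ _ _ _ setT) => //.
    by apply: emeasurable_sum => i; exact: msecg.
    by move=> j x _; apply: sume_ge0 => i _; rewrite lee_fin.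
  apply: (@le_trans _ _ (\int[mu]_(x in `[0%R, (2 * pi / P%:R)%R[) (P%:R ^+ 2 * c)%:E)).
    apply: ge0_le_integral => //=.
    - by move=> x _; apply: sume_ge0 => j _; apply: sume_ge0 => i _; rewrite lee_fin.
    - apply: (@measurable_funS _ _ _ _ setT) => //.
      by apply: emeasurable_sum => j; apply: emeasurable_sum => i; exact: msecg.
    - move=> x _; under eq_bigr do rewrite sumEFin.
      by rewrite sumEFin lee_fin.
  by rewrite integral_cst//= lebesgue_measure_itv/= lte_fin h0 oppr0 addr0.
apply: (@le_trans _ _ (\int[mu]_(t in `[0%R, (2 * pi / P%:R)%R[)
    (P%:R ^+ 2 * c * (2 * pi / P%:R))%:E)).
  apply: ge0_le_integral => //=.
  - by move=> t _; apply: sume_ge0.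
  - apply: (@measurable_funS _ _ _ _ setT) => //.
    apply: emeasurable_sum => j.
    by apply: (measurableT_comp mI); exact: measurable_funD.
rewrite integral_cst//= lebesgue_measure_itv/= lte_fin h0 oppr0 addr0 -EFinM lee_fin.
rewrite le_eqVlt; apply/orP; left; apply/eqP; field.
by rewrite gt_eqF.
Qed.

(** For such [t] all the phases [j * t], [j < M], lie in [[0, 1]], so each exponential has real part
    at least [cos 1]. *)
Lemma fejer_lower_bound (M : nat) (t : R) : (0 < M)%N -> (0 <= t <= M%:R^-1)%R ->
  (cos 1 ^+ 2 * M%:R <= fejer M t)%R.
Proof.
move=> M0 /andP[t0 tM]; have MR : (0 < M%:R :> R)%R by rewrite ltr0n.
rewrite /fejer ler_pdivlMl//.
rewrite [leLHS](_ : _ = (cos 1 * M%:R) ^+ 2)%R; last by ring.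
have c0 : (0 <= cos 1 * M%:R :> R)%R by rewrite mulr_ge0// ltW// cos1_gt0.
rewrite ler_pXn2r// ?nnegrE ?normc_ge0//.
set z : R[i] := (\sum_(j < M) expi _)%R.
have zE : complex.Re z = (\sum_(j < M) cos (j%:R * t))%R.
  by rewrite /z; elim/big_rec2: _ => // j y1 y2 _ <-; case: y2.
apply: (@le_trans _ _ (complex.Re z)).
  rewrite zE; apply: (@le_trans _ _ (\sum_(j < M) cos 1)%R).
    by rewrite sumr_const card_ord mulr_natr.
  apply: ler_sum => j _.
  have j1 : (j%:R * t <= 1)%R.
    apply: (@le_trans _ _ (M%:R * M%:R^-1)%R); last by rewrite divff// gt_eqF.
    by rewrite ler_pM// ler_nat ltnW.
  rewrite leNgt ltr_cos ?in_itv/=; last 2 first.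
  - by rewrite ler01 (le_trans _ (pi_ge2 R))// ler1n.
  - by rewrite mulr_ge0//= (le_trans j1)// (le_trans _ (pi_ge2 R))// ler1n.
  by rewrite -leNgt.
case: (z) => a b /=; apply: le_trans (ler_norm _) _.
by rewrite -sqrtr_sqr ler_wsqrtr// lerDl sqr_ge0.
Qed.

Lemma measurable_normc d (T : measurableType d) (f : T -> R[i]) :
  measurable_fun setT (fun x => complex.Re (f x)) ->
  measurable_fun setT (fun x => complex.Im (f x)) ->
  measurable_fun setT (fun x => Normc.normc (f x)).
Proof.
move=> mRe mIm; rewrite (_ : (fun x => _) = (fun x =>
   Num.sqrt (complex.Re (f x) ^+ 2 + complex.Im (f x) ^+ 2))%R).
  apply: measurableT_comp; first by apply: continuous_measurable_fun; exact: sqrt_continuous.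
  by apply: measurable_funD; exact: measurable_funX.
by apply/funext => x; case: (f x).
Qed.

Lemma measurable_trig d (T : measurableType d) (f : T -> R) : measurable_fun setT f ->
  measurable_fun setT (fun x => cos (f x)) /\ measurable_fun setT (fun x => sin (f x)).
Proof.
move=> mf; split; apply: measurableT_comp => //; apply: continuous_measurable_fun.
  exact: continuous_cos.
exact: continuous_sin.
Qed.

Lemma measurable_ReIm_airy_sum N (a : nat -> R[i]) :
  measurable_fun setT (fun z : R * R => complex.Re (airy_sum N a z.1 z.2)) /\
  measurable_fun setT (fun z : R * R => complex.Im (airy_sum N a z.1 z.2)).
Proof.
have mph (m n : R) : measurable_fun setT (fun z : R * R => m * z.1 - n * z.2)%R.
  by apply: measurable_funB; apply: measurable_funM.
split.
  rewrite (_ : (fun z => _) = (fun z : R * R => \sum_(k < (2 * N).+1)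
     (complex.Re (a k) * cos (k%:Z%:~R * z.1 - (k%:Z ^+ 3)%:~R * z.2)
       - complex.Im (a k) * sin (k%:Z%:~R * z.1 - (k%:Z ^+ 3)%:~R * z.2)))%R).
    apply: measurable_sum => k; have [? ?] := measurable_trig (mph k%:Z%:~R (k%:Z ^+ 3)%:~R).
    by apply: measurable_funB; exact: measurable_funM.
  apply/funext => z; rewrite /airy_sum; elim/big_rec2: _ => // k y1 y2 _ <-.
  by rewrite /wave; case: (a k) => u v; case: y2.
rewrite (_ : (fun z => _) = (fun z : R * R => \sum_(k < (2 * N).+1)
   (complex.Re (a k) * sin (k%:Z%:~R * z.1 - (k%:Z ^+ 3)%:~R * z.2)
     + complex.Im (a k) * cos (k%:Z%:~R * z.1 - (k%:Z ^+ 3)%:~R * z.2)))%R).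
  apply: measurable_sum => k; have [? ?] := measurable_trig (mph k%:Z%:~R (k%:Z ^+ 3)%:~R).
  by apply: measurable_funD; exact: measurable_funM.
apply/funext => z; rewrite /airy_sum; elim/big_rec2: _ => // k y1 y2 _ <-.
by rewrite /wave; case: (a k) => u v; case: y2.
Qed.

Lemma measurable_airy_sum N (a : nat -> R[i]) :
  measurable_fun setT (fun z : R * R => Normc.normc (airy_sum N a z.1 z.2)).
Proof. by have [? ?] := measurable_ReIm_airy_sum N a; exact: measurable_normc. Qed.

End TorusAverage.

(** * Space-time norms of exponential sums *)

Section SpacetimeBound.
Context {R : realType}.
Local Notation mu := (@lebesgue_measure R).
Local Open Scope ereal_scope.

(** On [[0, T]] the Fejer kernel divided by [cos 1 ^ 2 * M] is at least 1. Inserting it and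
    enlarging the time interval to a full period gives an integral controlled by [grid_decoupling];
    the division by [M] is the gain from the short time. *)
Lemma airy_sum_L6 (eps : R) : (0 < eps)%R -> exists C : R, (0 < C)%R /\
  forall (N M : nat) (a : nat -> R[i]) (T : R), (0 < M <= N)%N ->
    (forall k, a k != 0%R -> (N <= 2 * k)%N) -> (T <= M%:R^-1)%R ->
    \int[mu]_(t in `[0%R, T]) \int[mu]_(x in `[0%R, (2 * pi)%R[)
      (Normc.normc (airy_sum N a x t) ^+ 6)%:E
    <= (C * (N%:R `^ eps / M%:R)
        * (\sum_(k < (2 * N).+1) Normc.normc (a k) ^+ 2) ^+ 3)%:E.
Proof.
move=> /grid_decoupling[C [C0 hC]].
have c10 : (0 < cos 1 ^+ 2 :> R)%R by rewrite exprn_gt0// cos1_gt0.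
exists ((2 * pi) ^+ 2 * C / cos 1 ^+ 2)%R; split.
  by rewrite divr_gt0// mulr_gt0// exprn_gt0// mulr_gt0// pi_gt0.
move=> N M a T MN aN TM; have /andP[M0 MN'] := MN.
have N0 : (0 < N)%N by apply: leq_trans MN'.
have MR : (0 < M%:R :> R)%R by rewrite ltr0n.
pose P := (32 * N ^ 3)%N.
have P0 : (0 < P)%N by rewrite muln_gt0/= expn_gt0 N0.
pose H (z : R * R) : R := (Normc.normc (airy_sum N a z.1 z.2) ^+ 6)%R.
pose g (z : R * R) : R := ((cos 1 ^+ 2 * M%:R)^-1 * (fejer M z.2 * H z))%R.
have mH : measurable_fun setT H by apply: measurable_funX; exact: measurable_airy_sum.
have H0 z : (0 <= H z)%R by rewrite exprn_ge0 ?normc_ge0.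
have mfejer : measurable_fun setT (@fejer R M).
  apply: measurable_funM => //; apply: measurable_funX.
  (* The sum in the kernel is an [airy_sum] at time 0, with coefficients 1 below [M] and with [t] as
     the space variable; its measurability is already known. *)
  rewrite (_ : (fun t => _) = (fun t : R => Normc.normc
     (airy_sum M (fun k => if (k < M)%N then 1 else 0)%R t 0))).
    apply: (@measurableT_comp _ _ _ _ _ _ (fun z : R * R => Normc.normc (airy_sum M
      (fun k => if (k < M)%N then 1 else 0)%R z.1 z.2)) _ (fun t : R => (t, 0%R : R))).
      exact: measurable_airy_sum.
    exact: pair2_measurable.
  apply/funext => t; congr Normc.normc; rewrite /airy_sum.
  rewrite (big_ord_widen_cond (2 * M).+1 xpredT (fun j => expi (j%:R * t)))%R; last by clear; lia.
  rewrite big_mkcond/=; apply: eq_bigr => k _.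
  by case: ifP => _; rewrite ?mul1r ?mul0r// /wave mulr0 subr0.
have mg : measurable_fun setT g.
  apply: measurable_funM => //; apply: measurable_funM => //.
  by apply: (measurableT_comp mfejer).
have g0 z : (0 <= g z)%R.
  apply: mulr_ge0; last by apply: mulr_ge0; [exact: fejer_ge0|exact: H0].
  by apply: ltW; rewrite invr_gt0 mulr_gt0.
have Hg x t : (0 <= t <= T)%R -> (H (x, t) <= g (x, t))%R.
  move=> /andP[t0 tT]; rewrite /g /= mulrA ler_peMl//.
  rewrite ler_pdivlMl; last exact: mulr_gt0.
  rewrite mulr1; apply: fejer_lower_bound => //.
  by rewrite t0 (le_trans tT).
have T2pi : (T < 2 * pi)%R.
  apply: (le_lt_trans TM); apply: (@le_lt_trans _ _ 1%R).
    by rewrite invf_le1// ler1n.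
  by have := pi_ge2 R; lra.
have mIg : measurable_fun setT (fun t => \int[mu]_(x in `[0%R, (2 * pi)%R[) (g (x, t))%:E).
  exact: measurable_integral_fst.
have mIH : measurable_fun setT (fun t => \int[mu]_(x in `[0%R, (2 * pi)%R[) (H (x, t))%:E).
  exact: measurable_integral_fst.
have msec (G : R * R -> R) t : measurable_fun setT G ->
    measurable_fun `[0%R, (2 * pi)%R[%classic (fun x => (G (x, t))%:E).
  move=> mG; apply: (@measurable_funS _ _ _ _ setT) => //; apply/measurable_EFinP.
  by apply: measurableT_comp => //; exact: pair2_measurable.
apply: (@le_trans _ _ (\int[mu]_(t in `[0%R, T]) \int[mu]_(x in `[0%R, (2 * pi)%R[) (g (x, t))%:E)).
  apply: ge0_le_integral => //=.
  - by move=> t _; apply: integral_ge0 => x _; rewrite lee_fin; exact: (H0 (x, t)).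
  - exact: (@measurable_funS _ _ _ _ setT).
  - exact: (@measurable_funS _ _ _ _ setT).
  - move=> t; rewrite in_itv/= => tT; apply: ge0_le_integral => //=.
    + by move=> x _; rewrite lee_fin; exact: (H0 (x, t)).
    + exact: (msec H).
    + exact: (msec g).
    + by move=> x _; rewrite lee_fin; exact: Hg.
apply: (@le_trans _ _ (\int[mu]_(t in `[0%R, (2 * pi)%R[)
    \int[mu]_(x in `[0%R, (2 * pi)%R[) (g (x, t))%:E)).
  apply: ge0_subset_integral => //=.
  - exact: (@measurable_funS _ _ _ _ setT).
  - by move=> t _; apply: integral_ge0 => x _; rewrite lee_fin.
  - by move=> t /=; rewrite !in_itv/= => /andP[-> /le_lt_trans]; exact.
set S3 := (_ ^+ 3)%R.
pose c := ((cos 1 ^+ 2 * M%:R)^-1 * (C * N%:R `^ eps * S3))%R.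
apply: le_trans (@torus_integral_le_grid R g c P P0 mg g0 _) _.
  move=> x t; have := hC N M P a x t MN aN erefl; rewrite -/S3 => h.
  rewrite /g /H /=; under eq_bigr => j _ do rewrite -mulr_sumr.
  rewrite -mulr_sumr /c mulrCA ler_wpM2l// invr_ge0 mulr_ge0 ?ler0n// ltW//.
rewrite lee_fin le_eqVlt; apply/orP; left; apply/eqP; rewrite /c; field.
by rewrite !gt_eqF// cos1_gt0.
Qed.

(** The complement of [D] is negligible for the restricted measure, and inside [D] the two measures
    agree. *)
Lemma ge0_integral_mrestr (D : set R) (mD : measurable D) (f : R -> \bar R) :
  measurable_fun setT f -> (forall x, 0 <= f x) ->
  \int[mrestr mu mD]_x f x = \int[mu]_(x in D) f x.
Proof.
move=> mf f0; rewrite (@ge0_negligible_integral _ _ _ (mrestr mu mD) setT (~` D) f)//=.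
- rewrite setTD setCK; apply: eq_measure_integral => A mA AD.
  by rewrite -[LHS]/(mu (A `&` D)) setIidl.
- exact: measurableC.
- by rewrite -[LHS]/(mu (~` D `&` D)) setICl measure0.
Qed.

Lemma torus_LnormE (p : nat) (f : R -> R[i]) : (0 < p)%N ->
  measurable_fun setT (fun x => Normc.normc (f x)) ->
  torus_Lnorm p%:R f =
    (\int[mu]_(x in `[0%R, (2 * pi)%R[) (Normc.normc (f x) ^+ p)%:E) `^ p%:R^-1.
Proof.
move=> p0 mf; rewrite /torus_Lnorm unlock /lebesgue_on ge0_integral_mrestr//.
- congr (_ `^ _); apply: eq_integral => x _.
  by rewrite /= ger0_norm ?normc_ge0// powR_mulrn// normc_ge0.
- apply: (@measurableT_comp _ _ _ _ _ _ (fun x : \bar R => x `^ p%:R)) => //.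
    exact: measurable_poweR.
  by apply: measurableT_comp => //; exact/measurable_EFinP.
- by move=> x; exact: poweR_ge0.
Qed.

Lemma spacetime_LnormE (p : nat) (T : R) (v : R -> R -> R[i]) : (0 < p)%N ->
  measurable_fun setT (fun z : R * R => Normc.normc (v z.2 z.1)) ->
  spacetime_Lnorm p%:R p%:R T v =
    (\int[mu]_(t in `[0%R, T]) \int[mu]_(x in `[0%R, (2 * pi)%R[)
      (Normc.normc (v t x) ^+ p)%:E) `^ p%:R^-1.
Proof.
move=> p0 mv.
have mI : measurable_fun setT
    (fun t => \int[mu]_(x in `[0%R, (2 * pi)%R[) (Normc.normc (v t x) ^+ p)%:E).
  apply: (@measurable_integral_fst _ (fun z => Normc.normc (v z.2 z.1) ^+ p)%R) => //.
  - exact: measurable_funX.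
  - by move=> z; rewrite exprn_ge0 ?normc_ge0.
have I0 t : 0 <= \int[mu]_(x in `[0%R, (2 * pi)%R[) (Normc.normc (v t x) ^+ p)%:E.
  by apply: integral_ge0 => x _; rewrite lee_fin exprn_ge0 ?normc_ge0.
have E t : `|torus_Lnorm p%:R (v t)| `^ p%:R
    = \int[mu]_(x in `[0%R, (2 * pi)%R[) (Normc.normc (v t x) ^+ p)%:E.
  rewrite torus_LnormE//; last exact: (measurableT_comp mv (pair2_measurable t)).
  by rewrite gee0_abs ?poweR_ge0// -poweRrM mulVf ?poweRe1// pnatr_eq0 -lt0n.
rewrite /spacetime_Lnorm unlock; under eq_integral do rewrite E.
by rewrite /lebesgue_on ge0_integral_mrestr.
Qed.

End SpacetimeBound.

(** * Bessel's inequality *)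

Section Bessel.
Context {R : realType}.
Local Notation mu := (@lebesgue_measure R).
Local Notation D := [set` torus_itv R].

Let mD : measurable (D : set (measurableTypeR R)). Proof. exact: measurable_itv. Qed.

Lemma Rintegral_sum (I : Type) (s : seq I) (F : I -> R -> R) :
  (forall i, mu.-integrable D (EFin \o F i)) ->
  mu.-integrable D (EFin \o (fun x => \sum_(i <- s) F i x)) /\
  (\int[mu]_(x in D) (\sum_(i <- s) F i x) = \sum_(i <- s) \int[mu]_(x in D) F i x)%R.
Proof.
move=> iF; elim: s => [|i s [ih1 ih2]].
  rewrite big_nil; split.
    rewrite (_ : _ \o _ = cst 0%E); first exact: integrable0.
    by apply/funext => x /=; rewrite big_nil.
  by under eq_Rintegral do rewrite big_nil; rewrite Rintegral_cst// mul0r.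
split.
  rewrite (_ : _ \o _ = (EFin \o F i) \+ (EFin \o (fun x => (\sum_(i <- s) F i x)%R)))%E.
    exact: integrableD.
  by apply/funext => x /=; rewrite big_cons EFinD.
under eq_Rintegral do rewrite big_cons.
by rewrite RintegralD// ih2 big_cons.
Qed.

(** Parseval is an exact identity on every grid with [P] points, since [P] exceeds all the
    differences of frequencies; folding the period onto one cell transfers it to the integral. *)
Lemma trig_poly_L2 (m P : nat) (iota : 'I_m -> int) (c : 'I_m -> R[i]) : (0 < P)%N ->
    (forall k l, k != l -> iota k - iota l != 0 /\ (`|iota k - iota l| < P)%N) ->
  mu.-integrable D (EFin \o (fun x =>
      Normc.normc (\sum_k c k * expi ((iota k)%:~R * x)) ^+ 2)) /\
  (\int[mu]_(x in D)
      (Normc.normc (\sum_k c k * expi ((iota k)%:~R * x)) ^+ 2)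
    = 2 * pi * \sum_k Normc.normc (c k) ^+ 2)%R.
Proof.
move=> P0 sepi; have PR : 0 < P%:R :> R by rewrite ltr0n.
have h0 : 0 < 2 * pi / P%:R :> R by rewrite divr_gt0// mulr_gt0 ?pi_gt0.
pose g x := \sum_k c k * expi ((iota k)%:~R * x).
have mlin (n : R) : measurable_fun setT (fun x : R => n * x) by exact: measurable_funM.
have mtrig n := measurable_trig (mlin n).
have mg : measurable_fun setT (fun x => Normc.normc (g x)).
  apply: measurable_normc.
    rewrite (_ : (fun x => _) = (fun x : R => \sum_k
       (complex.Re (c k) * cos ((iota k)%:~R * x) - complex.Im (c k) * sin ((iota k)%:~R * x)))).
      apply: measurable_sum => k; have [? ?] := mtrig (iota k)%:~R.
      by apply: measurable_funB; exact: measurable_funM.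
    apply/funext => x; rewrite /g; elim/big_rec2: _ => // k y1 y2 _ <-.
    by case: (c k) => u v; case: y2.
  rewrite (_ : (fun x => _) = (fun x : R => \sum_k
     (complex.Re (c k) * sin ((iota k)%:~R * x) + complex.Im (c k) * cos ((iota k)%:~R * x)))).
    apply: measurable_sum => k; have [? ?] := mtrig (iota k)%:~R.
    by apply: measurable_funD; exact: measurable_funM.
  apply/funext => x; rewrite /g; elim/big_rec2: _ => // k y1 y2 _ <-.
  by case: (c k) => u v; case: y2.
have grid x : \sum_(i < P) Normc.normc (g (grid_pt P x i)) ^+ 2
    = P%:R * \sum_k Normc.normc (c k) ^+ 2.
  apply: complexI; rewrite rmorph_sum/=.
  under eq_bigr => i _.
    rewrite -mulcJ /g rmorph_sum mulr_suml.
    under eq_bigr => k _ do rewrite mulr_sumr.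
    over.
  rewrite exchange_big/= rmorphM/= rmorph_sum/= mulr_sumr; apply: eq_bigr => k _.
  rewrite exchange_big/= (bigD1 k)//= [X in _ + X]big1 ?addr0 => [|l lk].
    under eq_bigr => i _ do rewrite mulcJ Normc.normcM normc_expi mulr1.
    by rewrite sumr_const card_ord -[LHS]mulr_natl rmorph_nat.
  have [kl1 kl2] := sepi k l (contra_neq esym lk).
  rewrite (_ : \sum_(i < P) _ = c k * ((c l)^*)%C *
     \sum_(i < P) expi ((iota k - iota l)%:~R * grid_pt P x i)).
    by rewrite sum_expi_grid_eq0 ?mulr0.
  rewrite mulr_sumr; apply: eq_bigr => i _.
  rewrite rmorphM/= -[in RHS](_ : expi ((iota k)%:~R * grid_pt P x i) *
     expi (- ((iota l)%:~R * grid_pt P x i)) = expi ((iota k - iota l)%:~R * grid_pt P x i)).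
    by rewrite expiN; ring.
  by rewrite -expiD; congr expi; rewrite intrB; ring.
have mg2 : measurable_fun setT (fun x => (Normc.normc (g x) ^+ 2)%:E).
  by apply/measurable_EFinP; exact: measurable_funX.
have Ig : (\int[mu]_(x in D) (Normc.normc (g x) ^+ 2)%:E
    = (2 * pi * \sum_k Normc.normc (c k) ^+ 2)%:E)%E.
  rewrite (ge0_integral_grid P0) => [|//|x]; last by rewrite lee_fin exprn_ge0 ?normc_ge0.
  under eq_integral => x _ do rewrite sumEFin (grid x).
  rewrite integral_cst//= lebesgue_measure_itv/= lte_fin h0 oppr0 adde0 -EFinM; congr EFin.
  by field; rewrite gt_eqF.
rewrite -/g; split; last by rewrite /Rintegral Ig.
apply/integrableP; split; first exact: measurable_funTS.
rewrite (_ : integral _ _ _ = \int[mu]_(x in D) (Normc.normc (g x) ^+ 2)%:E)%E.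
  by rewrite Ig ltry.
by apply: eq_integral => x _; rewrite /= ger0_norm// exprn_ge0 ?normc_ge0.
Qed.

End Bessel.

Section BesselInequality.
Context {R : realType}.
Local Notation mu := (@lebesgue_measure R).
Local Notation D := [set` torus_itv R].

Let mD : measurable (D : set (measurableTypeR R)). Proof. exact: measurable_itv. Qed.

Lemma Re_mul (u v : R[i]) :
  complex.Re (u * v) = complex.Re u * complex.Re v - complex.Im u * complex.Im v.
Proof. by case: u v => ? ? []. Qed.

Lemma Im_mul (u v : R[i]) :
  complex.Im (u * v) = complex.Re u * complex.Im v + complex.Im u * complex.Re v.
Proof. by case: u v => ? ? []. Qed.

Lemma Re_sum (I : Type) (s : seq I) (F : I -> R[i]) :
  complex.Re (\sum_(i <- s) F i) = \sum_(i <- s) complex.Re (F i).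
Proof. by elim/big_rec2: _ => // i y1 y2 _ <-; case: (F i) => ? ?; case: y2. Qed.

Lemma normc_ge_Re (z : R[i]) : `|complex.Re z| <= Normc.normc z.
Proof. by case: z => a b /=; rewrite -sqrtr_sqr ler_wsqrtr// lerDl sqr_ge0. Qed.

Lemma normc_ge_Im (z : R[i]) : `|complex.Im z| <= Normc.normc z.
Proof. by case: z => a b /=; rewrite -sqrtr_sqr ler_wsqrtr// lerDr sqr_ge0. Qed.

Lemma Re_mul_conjc_le (u v : R[i]) :
  2 * complex.Re (u * (v^*)%C) <= Normc.normc u ^+ 2 + Normc.normc v ^+ 2.
Proof.
rewrite !normc_sqr; case: u v => a b [c d] /=.
have := sqr_ge0 (a - c); have := sqr_ge0 (b - d); rewrite !sqrrB; lra.
Qed.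

Lemma L2_torus_sqr (f : R -> R[i]) : L2_torus f ->
  mu.-integrable D (EFin \o (fun x => Normc.normc (f x) ^+ 2)) /\
  (\int[mu]_(x in D) (Normc.normc (f x) ^+ 2) = fine (torus_Lnorm 2 f) ^+ 2)%R.
Proof.
move=> [_ mRe mIm fin]; have mf := measurable_normc mRe mIm.
have E := torus_LnormE (ltn0Sn 1) mf.
rewrite E in fin *; set I := integral _ _ _ in fin *.
have I0 : (0 <= I)%E by apply: integral_ge0 => x _; rewrite lee_fin exprn_ge0 ?normc_ge0.
have Ifin : (I < +oo)%E by apply: lty_poweRy fin; rewrite invr_eq0.
split.
  apply/integrableP; split.
    by apply/measurable_EFinP/measurable_funTS; exact: measurable_funX.
  rewrite (_ : integral _ _ _ = I)//; apply: eq_integral => x _.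
  by rewrite /= ger0_norm// exprn_ge0 ?normc_ge0.
rewrite fine_poweR -powR_mulrn ?powR_ge0// -powRrM mulVf// powRr1//.
exact: fine_ge0.
Qed.

Lemma L2_torus_integrable (f : R -> R[i]) (n : R) : L2_torus f ->
  mu.-integrable D (EFin \o (fun x => complex.Re (f x * expi (- (n * x))))) /\
  mu.-integrable D (EFin \o (fun x => complex.Im (f x * expi (- (n * x))))).
Proof.
move=> hf; have [i2 _] := L2_torus_sqr hf; have [_ mRe mIm _] := hf.
have mlin : measurable_fun setT (fun x : R => - (n * x)).
  by apply: measurableT_comp => //; exact: measurable_funM.
have [mcos msin] := measurable_trig mlin.
(* A period has finite measure, so [|f| <= 1 + |f| ^ 2] gives integrability. *)
have dom : mu.-integrable D (EFin \o (fun x => 1 + Normc.normc (f x) ^+ 2)).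
  rewrite (_ : _ \o _ = (EFin \o cst 1%R) \+ (EFin \o (fun x => (Normc.normc (f x) ^+ 2)%R)))%E//.
  apply: integrableD => //; apply/integrableP; split; first exact/measurable_EFinP.
  under eq_integral => x _ do rewrite /= normr1.
  by rewrite integral_cst//= mul1e lebesgue_measure_itv/=; case: ifP; rewrite ?ltry.
have le (z : R[i]) (y r : R) : `|y| <= Normc.normc (z * expi r) -> `|y| <= `|1 + Normc.normc z ^+ 2|.
  rewrite Normc.normcM normc_expi mulr1 => h; apply: le_trans h _.
  rewrite ger0_norm ?addr_ge0 ?sqr_ge0//.
  by have := sqr_ge0 (Normc.normc z - 1); have := normc_ge0 z; nra.
split; apply: le_integrable dom => //.
- apply/measurable_EFinP/measurable_funTS.
  under eq_fun do rewrite Re_mul.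
  by apply: measurable_funB; exact: measurable_funM.
- by move=> x _; rewrite /= lee_fin; apply: le; exact: normc_ge_Re.
- apply/measurable_EFinP/measurable_funTS.
  under eq_fun do rewrite Im_mul.
  by apply: measurable_funD; exact: measurable_funM.
- by move=> x _; rewrite /= lee_fin; apply: le; exact: normc_ge_Im.
Qed.

(** Integrating [2 Re (f conj(g)) <= |f| ^ 2 + |g| ^ 2], where [g] is the partial Fourier sum of
    [f], gives twice the sum of squares on the left and once on the right. *)
Lemma bessel_inequality (f : R -> R[i]) (m P : nat) (iota : 'I_m -> int) : (0 < P)%N ->
    (forall k l, k != l -> iota k - iota l != 0 /\ (`|iota k - iota l| < P)%N) ->
    L2_torus f ->
  2 * pi * \sum_k Normc.normc (fourier_coef f (iota k)) ^+ 2
    <= fine (torus_Lnorm 2 f) ^+ 2.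
Proof.
move=> P0 sepi hf; have [i2 <-] := L2_torus_sqr hf.
pose c k := fourier_coef f (iota k); rewrite -/c.
have pi2 : 2 * pi != 0 :> R by rewrite mulf_neq0// gt_eqF// pi_gt0.
pose F k x := f x * expi (- ((iota k)%:~R * x)).
have ReF k : (\int[mu]_(x in D) complex.Re (F k x) = 2 * pi * complex.Re (c k))%R.
  by rewrite /c /fourier_coef Re_mul /= mul0r subr0 mulrA divff// mul1r.
have ImF k : (\int[mu]_(x in D) complex.Im (F k x) = 2 * pi * complex.Im (c k))%R.
  by rewrite /c /fourier_coef Im_mul /= mul0r addr0 mulrA divff// mul1r.
pose h k x := complex.Re (c k) * complex.Re (F k x) + complex.Im (c k) * complex.Im (F k x).
have iZ (r : R) (G : R -> R) : mu.-integrable D (EFin \o G) ->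
    mu.-integrable D (EFin \o (fun x => r * G x)).
  by move=> iG; apply: (eq_integrable mD _ _ (fun x _ => erefl) (integrableZl mD r iG)).
have iReF k : mu.-integrable D (EFin \o (fun x => complex.Re (c k) * complex.Re (F k x))).
  by apply: iZ; exact: (L2_torus_integrable _ hf).1.
have iImF k : mu.-integrable D (EFin \o (fun x => complex.Im (c k) * complex.Im (F k x))).
  by apply: iZ; exact: (L2_torus_integrable _ hf).2.
have ih k : mu.-integrable D (EFin \o h k).
  by apply: (eq_integrable mD _ _ (fun x _ => erefl) (integrableD mD (iReF k) (iImF k))).
have Ih k : (\int[mu]_(x in D) h k x = 2 * pi * Normc.normc (c k) ^+ 2)%R.
  rewrite RintegralD// RintegralZl//; last exact: (L2_torus_integrable _ hf).1.
  rewrite RintegralZl//; last exact: (L2_torus_integrable _ hf).2.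
  by rewrite ReF ImF normc_sqr; ring.
have [ihs Ihs] := Rintegral_sum (index_enum 'I_m) ih.
pose g x := \sum_k c k * expi ((iota k)%:~R * x).
have [ig2 Ig] := trig_poly_L2 c P0 sepi.
have pt x : 2 * \sum_k h k x <= Normc.normc (f x) ^+ 2 + Normc.normc (g x) ^+ 2.
  have -> : \sum_k h k x = complex.Re (f x * ((g x)^*)%C).
    have -> : ((g x)^*)%C = \sum_k ((c k * expi ((iota k)%:~R * x))^*)%C by rewrite -rmorph_sum.
    rewrite mulr_sumr Re_sum; apply: eq_bigr => k _.
    rewrite (_ : ((c k * expi ((iota k)%:~R * x))^*)%C
      = ((c k)^*)%C * expi (- ((iota k)%:~R * x))); last by rewrite expiN rmorphM.
    by rewrite mulrCA Re_mul /h /F; case: (c k) (f x * _) => ? ? [? ?] /=; ring.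
  exact: Re_mul_conjc_le.
have := le_Rintegral mD (iZ 2 _ ihs) (integrableD mD i2 ig2) (fun x _ => pt x).
rewrite RintegralZl// Ihs RintegralD// Ig.
under eq_bigr => k _ do rewrite Ih.
rewrite -mulr_sumr; lra.
Qed.

End BesselInequality.

(** * The Littlewood-Paley piece of the Airy evolution *)

(** The frequency 0 appears in both sums on the right, whence the condition on [F 0]. *)
Lemma sum_symmetric_range (V : nmodType) (N : nat) (F : int -> V) : F 0 = 0 ->
  \sum_(j < (4 * N).+1) F (j%:Z - (2 * N)%:Z)
    = \sum_(k < (2 * N).+1) F k%:Z + \sum_(k < (2 * N).+1) F (- k%:Z).
Proof.
move=> F0; rewrite -(big_mkord xpredT (fun j : nat => F (j%:Z - (2 * N)%:Z))).
rewrite (@big_cat_nat _ _ _ (2 * N)%N)//=; last by lia.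
rewrite addrC; congr (_ + _).
  rewrite -[X in \sum_(X <= _ < _) _]add0n big_addn big_mkord.
  rewrite (_ : ((4 * N).+1 - 2 * N)%N = (2 * N).+1); last by lia.
  by apply: eq_bigr => k _; rewrite PoszD addrK.
rewrite big_ord_recl oppr0 F0 add0r big_nat_rev big_mkord.
by apply: eq_bigr => k _; congr F; have := ltn_ord k; rewrite lift0 /bump; lia.
Qed.

Lemma conjc_mul (R : rcfType) (u v : R[i]) :
  ((u * v)^*)%C = ((u^*)%C * (v^*)%C).
Proof. exact: rmorphM. Qed.

Section LittlewoodPaley.
Context {R : realType} (psi : R -> R) (hpsi : lp_cutoff psi).
Context (N : nat) (N_gt0 : (0 < N)%N) (f : R -> R[i]).

Let cut (k : int) : R[i] := ((psi (k%:~R / N%:R))%:C)%C * fourier_coef f k.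

Definition lp_pos (k : nat) : R[i] := cut k%:Z.
(** The cube is odd, so conjugation sends the wave of frequency [-k] to that of frequency [k]. With
    conjugated coefficients the negative part is the conjugate of an [airy_sum], and one estimate
    covers both parts. *)
Definition lp_neg (k : nat) : R[i] := ((cut (- k%:Z))^*)%C.

Lemma cut_supp (k : int) : cut k != 0 -> N%:R <= 2 * `|k%:~R| :> R.
Proof.
move=> ck; have : psi (k%:~R / N%:R) != 0.
  by apply: contra_neq ck => p0; rewrite /cut p0 mul0r.
move=> /(lp_support hpsi)/andP[+ _].
rewrite normrM normfV [`|N%:R|]ger0_norm// ler_pdivlMr ?ltr0n//; lra.
Qed.

Lemma lp_pos_supp k : lp_pos k != 0 -> (N <= 2 * k)%N.
Proof. by move=> /cut_supp; rewrite -pmulrn normr_nat -natrM ler_nat. Qed.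

Lemma lp_neg_supp k : lp_neg k != 0 -> (N <= 2 * k)%N.
Proof.
rewrite /lp_neg conjc_eq0 => /cut_supp.
by rewrite mulrNz normrN -pmulrn normr_nat -natrM ler_nat.
Qed.

Lemma cut0 : cut 0 = 0.
Proof.
apply/eqP; apply: contraT => /cut_supp.
by rewrite normr0 mulr0 lern0 -leqn0 leqNgt N_gt0.
Qed.

Lemma lp_proj_airyE t g x : airy_propagator t f g ->
  lp_proj psi N g x = airy_sum N lp_pos x t + ((airy_sum N lp_neg x t)^*)%C.
Proof.
move=> [_ hg]; rewrite /lp_proj.
have -> : ((airy_sum N lp_neg x t)^*)%C = \sum_(k < (2 * N).+1)
    ((lp_neg k * wave k%:Z (k%:Z ^+ 3) x t)^*)%C by rewrite -rmorph_sum.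
pose F (k : int) := cut k * wave k (k ^+ 3) x t.
rewrite (_ : airy_sum _ _ _ _ = \sum_(k < (2 * N).+1) F k%:Z)//.
rewrite (_ : \sum_(k < _) (_^*)%C = \sum_(k < (2 * N).+1) F (- k%:Z)); last first.
  apply: eq_bigr => k _; rewrite /lp_neg conjc_mul conjcK conjc_wave /F; congr (_ * wave _ _ _ _); ring.
rewrite -sum_symmetric_range; last by rewrite /F cut0 mul0r.
apply: eq_bigr => j _; move: (_ - _) => k /=.
have -> : F k = cut k * (expi (- (t * k%:~R ^+ 3)) * expi (k%:~R * x)).
  by rewrite /F /wave -expiD; congr (_ * expi _); rewrite rmorphXn/=; ring.
by rewrite hg /cut; ring.
Qed.

Lemma lp_mass : L2_torus f ->
  \sum_(k < (2 * N).+1) Normc.normc (lp_pos k) ^+ 2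
    + \sum_(k < (2 * N).+1) Normc.normc (lp_neg k) ^+ 2 <= fine (torus_Lnorm 2 f) ^+ 2.
Proof.
move=> hf; under [X in _ + X <= _]eq_bigr => k _ do rewrite normc_conjc.
rewrite -(@sum_symmetric_range _ N (fun k => Normc.normc (cut k) ^+ 2)); last first.
  by rewrite cut0 Normc.normc0 expr0n.
pose iota (j : 'I_(4 * N).+1) := j%:Z - (2 * N)%:Z.
have sepi k l : k != l -> iota k - iota l != 0 /\ (`|iota k - iota l| < (4 * N).+1)%N.
  move=> kl; have kl' : (k : nat) <> l by move=> e; case/eqP: kl; exact: val_inj.
  by rewrite /iota; have := ltn_ord k; have := ltn_ord l; split; lia.
apply: le_trans (bessel_inequality (ltn0Sn _) sepi hf).
set S := (X in 2 * pi * X).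
have S0 : 0 <= S by apply: sumr_ge0 => k _; rewrite exprn_ge0 ?normc_ge0.
(* The factor [2 pi >= 1] from Bessel's inequality is dropped. *)
apply: (@le_trans _ _ S); last first.
  by rewrite ler_peMl//; have := pi_ge2 R; lra.
apply: ler_sum => k _; rewrite ler_pXn2r ?nnegrE ?normc_ge0//.
have /andP[p0 p1] := lp_range hpsi ((iota k)%:~R / N%:R).
by rewrite /cut Normc.normcM normc_real// ler_piMl ?normc_ge0.
Qed.

End LittlewoodPaley.

(** * The estimate for the localized evolution and the choice of the time scale *)

Section Final.
Context {R : realType}.
Local Notation mu := (@lebesgue_measure R).

Lemma ge0_integral2_scale_sum (T c : R) (g1 g2 : R * R -> R) : 0 <= c ->
    measurable_fun setT g1 -> measurable_fun setT g2 ->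
    (forall z, 0 <= g1 z) -> (forall z, 0 <= g2 z) ->
  (\int[mu]_(t in `[0%R, T]) \int[mu]_(x in `[0%R, (2 * pi)%R[)
      (c * (g1 (x, t) + g2 (x, t)))%:E
   = c%:E * (\int[mu]_(t in `[0%R, T]) \int[mu]_(x in `[0%R, (2 * pi)%R[) (g1 (x, t))%:E
     + \int[mu]_(t in `[0%R, T]) \int[mu]_(x in `[0%R, (2 * pi)%R[) (g2 (x, t))%:E))%E.
Proof.
move=> c0 m1 m2 p1 p2.
have sec (g : R * R -> R) t : measurable_fun setT g ->
    measurable_fun `[0%R, (2 * pi)%R[%classic (fun x => (g (x, t))%:E).
  move=> mg; apply: (@measurable_funS _ _ _ _ setT) => //; apply/measurable_EFinP.
  by apply: measurableT_comp => //; exact: pair2_measurable.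
have mI (g : R * R -> R) : measurable_fun setT g -> (forall z, 0 <= g z) ->
    measurable_fun `[0%R, T]%classic (fun t => \int[mu]_(x in `[0%R, (2 * pi)%R[) (g (x, t))%:E)%E.
  move=> mg g0; apply: (@measurable_funS _ _ _ _ setT) => //.
  exact: measurable_integral_fst.
have I0 (g : R * R -> R) t : (forall z, 0 <= g z) ->
    (0 <= \int[mu]_(x in `[0%R, (2 * pi)%R[) (g (x, t))%:E)%E.
  by move=> g0; apply: integral_ge0 => x _; rewrite lee_fin.
have inner t : (\int[mu]_(x in `[0%R, (2 * pi)%R[) (c * (g1 (x, t) + g2 (x, t)))%:E
   = c%:E * (\int[mu]_(x in `[0%R, (2 * pi)%R[) (g1 (x, t))%:E
     + \int[mu]_(x in `[0%R, (2 * pi)%R[) (g2 (x, t))%:E))%E.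
  under eq_integral => x _ do rewrite EFinM EFinD.
  rewrite ge0_integralZl_EFin//=; last 2 first.
  - by move=> x _; rewrite adde_ge0// lee_fin.
  - by apply: emeasurable_funD; exact: sec.
  rewrite ge0_integralD//=.
  - by move=> x _; rewrite lee_fin.
  - exact: sec.
  - by move=> x _; rewrite lee_fin.
  - exact: sec.
under eq_integral => t _ do rewrite inner.
rewrite ge0_integralZl_EFin//=; last 2 first.
- by move=> t _; rewrite adde_ge0// I0.
- by apply: emeasurable_funD; exact: mI.
rewrite ge0_integralD//=.
- by move=> t _; exact: I0.
- exact: mI.
- by move=> t _; exact: I0.
- exact: mI.
Qed.

Lemma add_pow6_le (x y : R) : 0 <= x -> 0 <= y ->
  (x + y) ^+ 6 <= 64 * (x ^+ 6 + y ^+ 6).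
Proof.
wlog xy : x y / x <= y => [h x0 y0|x0 y0].
  by have [/h|/ltW/h] := leP x y; [exact|rewrite addrC [x ^+ 6 + _]addrC; exact].
apply: (@le_trans _ _ ((2 * y) ^+ 6)); first by rewrite ler_pXn2r// ?nnegrE; lra.
rewrite (_ : (2 * y) ^+ 6 = 64 * y ^+ 6); last by ring.
by rewrite ler_wpM2l// lerDr exprn_ge0.
Qed.

Lemma lp_airy_L6 (psi : R -> R) (eps : R) : lp_cutoff psi -> 0 < eps ->
  exists C : R, 0 < C /\
    forall (N M : nat) (T : R) (f : R -> R[i]) (u : R -> R -> R[i]),
      (0 < M <= N)%N -> T <= M%:R^-1 -> L2_torus f ->
      (forall t : R, airy_propagator t f (u t)) ->
      (spacetime_Lnorm 6 6 T (fun t => lp_proj psi N (u t))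
       <= (C * (N%:R `^ eps / M%:R) * fine (torus_Lnorm 2 f) ^+ 6)%:E `^ 6^-1)%E.
Proof.
move=> hpsi /airy_sum_L6[C [C0 hC]]; exists (64 * C); split; first by rewrite mulr_gt0.
move=> N M T f u MN TM hf hu; have /andP[M0 MN'] := MN.
have N0 : (0 < N)%N by apply: leq_trans MN'.
have vE t x := lp_proj_airyE hpsi N0 x (hu t).
set A := airy_sum N (lp_pos psi N f) in vE; set B := airy_sum N (lp_neg psi N f) in vE.
have [mRA mIA] := measurable_ReIm_airy_sum N (lp_pos psi N f).
have [mRB mIB] := measurable_ReIm_airy_sum N (lp_neg psi N f).
have mv : measurable_fun setT (fun z : R * R => Normc.normc (lp_proj psi N (u z.2) z.1)).
  apply: measurable_normc.
    rewrite (_ : (fun z => _) = (fun z : R * R => complex.Re (A z.1 z.2) + complex.Re (B z.1 z.2))).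
      exact: measurable_funD.
    by apply/funext => z; rewrite vE; case: (A _ _) (B _ _) => ? ? [].
  rewrite (_ : (fun z => _) = (fun z : R * R => complex.Im (A z.1 z.2) - complex.Im (B z.1 z.2))).
    exact: measurable_funB.
  by apply/funext => z; rewrite vE; case: (A _ _) (B _ _) => ? ? [].
have mA := measurable_airy_sum N (lp_pos psi N f).
have mB := measurable_airy_sum N (lp_neg psi N f).
rewrite (@spacetime_LnormE _ 6)//; apply: gt0_ler_poweR.
- by rewrite invr_ge0.
- rewrite in_itv/= leey andbT; apply: integral_ge0 => t _; apply: integral_ge0 => x _.
  by rewrite lee_fin exprn_ge0 ?normc_ge0.
- rewrite in_itv/= leey andbT lee_fin; apply: mulr_ge0.
    by apply: mulr_ge0; [rewrite mulr_ge0// ltW|rewrite divr_ge0 ?powR_ge0].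
  by rewrite exprn_ge0// fine_ge0// Lnorm_ge0.
pose g1 (z : R * R) := Normc.normc (A z.1 z.2) ^+ 6.
pose g2 (z : R * R) := Normc.normc (B z.1 z.2) ^+ 6.
have mg1 : measurable_fun setT g1 by exact: measurable_funX.
have mg2 : measurable_fun setT g2 by exact: measurable_funX.
have g10 z : 0 <= g1 z by rewrite exprn_ge0 ?normc_ge0.
have g20 z : 0 <= g2 z by rewrite exprn_ge0 ?normc_ge0.
have mI (g : R * R -> R) : measurable_fun setT g -> (forall z, 0 <= g z) ->
    measurable_fun `[0%R, T]%classic (fun t => \int[mu]_(x in `[0%R, (2 * pi)%R[) (g (x, t))%:E)%E.
  move=> mg g0; apply: (@measurable_funS _ _ _ _ setT) => //.
  exact: measurable_integral_fst.
pose gv (z : R * R) := Normc.normc (lp_proj psi N (u z.2) z.1) ^+ 6.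
have mgv : measurable_fun setT gv by exact: measurable_funX.
have gv0 z : 0 <= gv z by rewrite exprn_ge0 ?normc_ge0.
pose gs (z : R * R) := 64 * (g1 z + g2 z).
have mgs : measurable_fun setT gs by apply: measurable_funM => //; exact: measurable_funD.
have gs0 z : 0 <= gs z by rewrite mulr_ge0// addr_ge0.
have gvs z : gv z <= gs z.
  apply: (@le_trans _ _ ((Normc.normc (A z.1 z.2) + Normc.normc (B z.1 z.2)) ^+ 6)).
    rewrite /gv vE ler_pXn2r ?nnegrE ?addr_ge0 ?normc_ge0//.
    by apply: le_trans (le_normcD _ _) _; rewrite normc_conjc.
  by apply: add_pow6_le; exact: normc_ge0.
have sec (g : R * R -> R) t : measurable_fun setT g ->
    measurable_fun `[0%R, (2 * pi)%R[%classic (fun x => (g (x, t))%:E).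
  move=> mg; apply: (@measurable_funS _ _ _ _ setT) => //; apply/measurable_EFinP.
  by apply: measurableT_comp => //; exact: pair2_measurable.
apply: (@le_trans _ _ (\int[mu]_(t in `[0%R, T]) \int[mu]_(x in `[0%R, (2 * pi)%R[) (gs (x, t))%:E)%E).
  apply: ge0_le_integral => //=.
  - by move=> t _; apply: integral_ge0 => x _; rewrite lee_fin; exact: (gv0 (x, t)).
  - exact: (mI gv).
  - exact: (mI gs).
  - move=> t _; apply: ge0_le_integral => //=.
    + by move=> x _; rewrite lee_fin; exact: (gv0 (x, t)).
    + exact: (sec gv).
    + exact: (sec gs).
    + by move=> x _; rewrite lee_fin; exact: (gvs (x, t)).
rewrite (ge0_integral2_scale_sum _ _ mg1 mg2 g10 g20)//.
have h1 := hC N M _ T MN (@lp_pos_supp R psi hpsi N N0 f) TM.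
have h2 := hC N M _ T MN (@lp_neg_supp R psi hpsi N N0 f) TM.
apply: le_trans (lee_wpmul2l _ (leeD h1 h2)) _; first by rewrite lee_fin.
rewrite -EFinD -EFinM lee_fin.
have := lp_mass hpsi N0 hf.
set p := \sum_(k < _) _; set q := \sum_(k < _) _; set F := fine _ => pq.
have p0 : 0 <= p by apply: sumr_ge0 => k _; rewrite exprn_ge0 ?normc_ge0.
have q0 : 0 <= q by apply: sumr_ge0 => k _; rewrite exprn_ge0 ?normc_ge0.
have E0 : 0 <= 64 * (C * (N%:R `^ eps / M%:R)).
  by rewrite mulr_ge0// mulr_ge0 ?(ltW C0)// divr_ge0 ?powR_ge0.
move: E0; set E := N%:R `^ eps / M%:R => E0.
rewrite [leLHS](_ : _ = 64 * (C * E) * (p ^+ 3 + q ^+ 3)); last by ring.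
rewrite [leRHS](_ : _ = 64 * (C * E) * F ^+ 6); last by ring.
(* The masses of the positive and the negative part together are at most [F ^ 2], and cubing is
   superadditive on nonnegative numbers. *)
rewrite ler_wpM2l//; apply: (@le_trans _ _ ((p + q) ^+ 3)).
  rewrite (_ : (p + q) ^+ 3 = p ^+ 3 + q ^+ 3 + 3 * (p * q) * (p + q)); last by ring.
  by rewrite lerDl !mulr_ge0// addr_ge0.
by rewrite (_ : 6%N = (2 * 3)%N)// exprM ler_pXn2r ?nnegrE ?addr_ge0 ?sqr_ge0.
Qed.

End Final.

Theorem proposition7p2 (R : realType) (psi : R -> R) (hpsi : lp_cutoff psi)
  (alpha : R) (halpha : 0 < alpha <= 2)
  (kappa : R) (hkappa : kappa < kappa0 alpha) :
  exists C : R, 0 < C /\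
    forall (n : nat) (f : R -> R[i]) (u : R -> R -> R[i]),
      let N := (2 ^ n)%N in
      L2_torus f ->
      (forall t : R, airy_propagator t f (u t)) ->
      (spacetime_Lnorm 6 6 (N%:R `^ (- alpha)) (fun t => lp_proj psi N (u t))
       <= (C * N%:R `^ (- kappa))%:E * torus_Lnorm 2 f)%E.
Proof.
have /andP[alpha0 _] := halpha.
(* The decoupling gains from times down to [1/N] only, so for [alpha > 1] the time interval is
   enlarged; this is why [kappa0] is constant there. *)
pose beta := Num.min alpha 1.
have beta0 : 0 < beta by rewrite lt_min alpha0 ltr01.
have beta_alpha : beta <= alpha by rewrite ge_min lexx.
have beta1 : beta <= 1 by rewrite ge_min lexx orbT.
have k0E : 6 * kappa0 alpha = beta.
  by rewrite /kappa0 /beta; case: leP => _; field.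
(* Chosen so that [eps - beta = - 6 * kappa]: the slack in [kappa] pays for the loss [N ^ eps]. *)
pose eps := 6 * (kappa0 alpha - kappa).
have eps0 : 0 < eps by rewrite mulr_gt0// subr_gt0.
have [C [C0 hC]] := lp_airy_L6 hpsi eps0.
(* The 2 comes from rounding [N ^ beta] to an integer, the root from the sixth power of the norm. *)
exists ((2 * C) `^ 6^-1); split; first by rewrite powR_gt0// mulr_gt0.
move=> n f u N hf hu.
have N1 : 1 <= N%:R :> R by rewrite ler1n expn_gt0.
have N0 : 0 < N%:R :> R by apply: lt_le_trans N1.
have Nb1 : 1 <= N%:R `^ beta.
  by rewrite -[leLHS](powRr0 N%:R) ler_powR// (ltW beta0).
(* Rounding down gives [M <= N] and [N ^ (- alpha) <= 1/M], and loses at most a factor 2 because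
   [N ^ beta >= 1]. *)
pose M := Num.truncn (N%:R `^ beta).
have /andP[MN MN'] : M%:R <= N%:R `^ beta < M.+1%:R.
  by apply: truncn_itv; rewrite powR_ge0.
have M0 : (0 < M)%N by rewrite -ltnS -(ltr_nat R); apply: le_lt_trans MN'.
have MR : 0 < M%:R :> R by rewrite ltr0n.
have MleN : (M <= N)%N.
  rewrite -(ler_nat R); apply: le_trans MN _.
  by rewrite -[leRHS]powRr1 ?(ltW N0)// ler_powR.
have TM : N%:R `^ (- alpha) <= M%:R^-1.
  rewrite powRN lef_pV2 ?posrE ?powR_gt0//; apply: le_trans MN _.
  by rewrite ler_powR.
have Mbig : N%:R `^ beta <= 2 * M%:R.
  apply: le_trans (ltW MN') _; rewrite -natr1.
  have : 1 <= M%:R :> R by rewrite ler1n.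
  lra.
have [_ _ _ fin] := hf.
have F0 : (0 <= torus_Lnorm 2 f)%E by exact: Lnorm_ge0.
rewrite -[torus_Lnorm 2 f in leRHS]fineK; last by rewrite ge0_fin_numE.
apply: le_trans (hC N M _ f u _ TM hf hu) _; first by rewrite M0.
set F := fine _; have {}F0 : 0 <= F by exact: fine_ge0.
rewrite -EFinM lee_fin.
have key : N%:R `^ eps / M%:R <= 2 * N%:R `^ (- (6 * kappa)).
  rewrite ler_pdivrMr// -mulrA mulrCA; apply: (@le_trans _ _ (N%:R `^ (- (6 * kappa)) * N%:R `^ beta)).
    rewrite -powRD; last by rewrite (gt_eqF N0) implybT.
    by rewrite /eps -k0E (_ : - _ + _ = 6 * (kappa0 alpha - kappa))//; ring.
  by rewrite ler_wpM2l ?powR_ge0.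
apply: (@le_trans _ _ ((2 * C * N%:R `^ (- (6 * kappa)) * F ^+ 6) `^ 6^-1)).
  apply: ge0_ler_powR; rewrite ?nnegrE ?invr_ge0 ?mulr_ge0 ?exprn_ge0 ?powR_ge0 ?invr_ge0 ?(ltW C0)//.
  rewrite ler_wpM2r ?exprn_ge0// [2 * C]mulrC -[leRHS]mulrA ler_wpM2l ?(ltW C0)//.
have C20 : 0 <= 2 * C by rewrite mulr_ge0// ltW.
rewrite powRM ?exprn_ge0 ?(mulr_ge0 C20) ?powR_ge0// [X in X * _]powRM ?powR_ge0//.
rewrite -[F ^+ 6]powR_mulrn// -!powRrM mulfV// powRr1//.
rewrite (_ : - (6 * kappa) / 6 = - kappa)//; by field.
Qed.
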